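(* There exists a constant $A>0$ such that, whenever $m=m(n)$ is a sequence of non-negative integers with $m\le n/14$, the chord diagram chosen uniformly at random among all chord diagrams with $n$ chords and $m$ crossings has, with probability tending to $1$ as $n\to\infty$, largest component of size at most $A\log n$.
   Context: A chord diagram with $n$ chords is a pairing (perfect matching) of the $2n$ points labeled $1,\dots,2n$ clockwise on a circle; each pair $\{a,b\}$ with $a<b$ is a chord. Two chords $\{a,b\}$, $\{c,d\}$ with $a<b$, $c<d$ cross if $a<c<b<d$ or $c<a<d<b$. The number of crossings is the number of unordered pairs of crossing chords. The intersection graph has the chords as vertices and the crossing pairs as edges; a component of the diagram is the set of chords forming a connected component of the intersection graph, and its size is its number of chords. *)

(* Defs.v *)
From mathcomp Require Import all_boot all_order all_algebra.

Set Implicit Arguments.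
Unset Strict Implicit.
Unset Printing Implicit Defensive.

(* The points 1, ..., 2n on the circle are encoded as
   0, ..., 2n - 1 : 'I_(2 * n); only their relative order matters. *)

Local Open Scope nat_scope.

Definition is_chord_diagram (n : nat) (D : {set {set 'I_(2 * n)}}) : bool :=
  partition D [set: 'I_(2 * n)] && [forall c in D, #|c| == 2].

Definition cross (n : nat) (c1 c2 : {set 'I_(2 * n)}) : bool :=
  [exists a, exists b, exists c, exists d,
    [&& c1 == [set a; b], c2 == [set c; d], a < b, c < d &
        [&& a < c, c < b & b < d] || [&& c < a, a < d & d < b]]].

Definition crossings (n : nat) (D : {set {set 'I_(2 * n)}}) : nat :=
  #|[set [set c1; c2] | c1 in D, c2 in D & cross c1 c2]|.

Definition chord_adj (n : nat) (D : {set {set 'I_(2 * n)}})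
    : rel {set 'I_(2 * n)} :=
  fun c1 c2 => [&& c1 \in D, c2 \in D & cross c1 c2].

Definition components (n : nat) (D : {set {set 'I_(2 * n)}})
    : {set {set {set 'I_(2 * n)}}} :=
  [set [set c2 in D | connect (chord_adj D) c1 c2] | c1 in D].

Definition largest_component (n : nat) (D : {set {set 'I_(2 * n)}}) : nat :=
  \max_(K in components D) #|K|.

Definition chord_diagrams (n m : nat) : {set {set {set 'I_(2 * n)}}} :=
  [set D | is_chord_diagram D & crossings D == m].

(* Probability of E under the uniform distribution on S (0 if S is empty). *)
Definition uniform_pr (R : numFieldType) (T : finType) (S : {set T})
    (E : pred T) : R :=
  (#|[set x in S | E x]|%:R / #|S|%:R)%R.

(* Main.v *)
Require Import Defs.
From mathcomp Require Import all_boot all_order all_algebra.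
From mathcomp Require Import zify ring lra.

(** A diagram is read from left to right as a word: a point that opens a chord
    gives [None], a point that closes one gives [Some l], where [l] is the
    number of chords opened after the chord being closed and still open. The
    labels add up to the number of crossings, the word determines the diagram
    ([letter_inj]), and the words that occur are exactly those in which every
    label is smaller than the current number of open chords and nothing stays
    open ([legal_letter] is the converse half). So [m] crossings are a weak
    composition of [m] on top of a Dyck path, up to the height constraint.

    Put [q = m / (n + m)], so that [q <= 1 / 15], and weigh a diagram with [n]
    chords and [m] crossings by [((1 - q) / 4) ^ n * q ^ m].

    Lower bound ([card_chord_diagrams_ge], [card_ge_weight]). Force the path to
    stay above a height [H] of order [log n]. This costs a factor [4 ^ H],
    polynomial in [n], and after it labels below [H] are always legal. Few
    compositions have a part that is [H] or more, and the central binomial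
    coefficient and the mode of the binomial distribution are within a
    polynomial factor of [4 ^ n] and of [q ^ -m * (1 - q) ^ -n]. Hence the total
    weight of the diagrams is at least the inverse of a polynomial in [n].

    Upper bound ([component_count]). Colour the points of a component with [k]
    chords red. No chord that is not red crosses or separates the red ones, so
    the coloured word is accepted by a small automaton ([accept_code]). Weigh
    red labels [l] by [2 ^ -l] in place of [q ^ l]. The automaton then has total
    weight at most [n * (8 * (1 - q)) ^ k] ([total_accept]), and undoing the
    change of weight gains [(2 * q) ^ j], where [j >= k - 1] is the number of
    crossings in the component, because the component is connected
    ([component_labels]). Together this is at most [8 * n * (16 * q * (1 - q)) ^ (k - 1)],
    and [16 * q * (1 - q) <= 224 / 225 < 1] when [q <= 1 / 15]. The bound
    [m <= n / 14] is what makes this base smaller than one.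

    So the probability of a component with more than [t] chords is at most a
    polynomial in [n] times [(224 / 225) ^ t] ([large_component_le]), and it
    tends to [0] for [t = A * log n] with [A] large. *)

Set Implicit Arguments.
Unset Strict Implicit.
Unset Printing Implicit Defensive.

(** * Coding a matching by opener and closer letters *)

Section Matchings.
Variable N : nat.
Implicit Types (f g : 'I_N -> 'I_N) (i j a c : 'I_N).

Definition matching f := involutive f /\ forall i, f i != i.
Definition chord f i : {set 'I_N} := [set i; f i].
Definition crossers f i : {set 'I_N} := [set c : 'I_N | (f i < c < i) && (i < f c)].
Definition crosses f a c := [&& a < c, c < f a & f a < f c].
Definition letter f i : option nat :=
  if f i < i then Some #|crossers f i| else None.

Lemma card_above_inj (O : {set 'I_N}) a c :
  a \in O -> c \in O ->
  #|[set x in O | a < x]| = #|[set x in O | c < x]| -> a = c.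
Proof.
move=> aO cO; wlog lt_ac : a c aO cO / a < c.
  move=> W E; have [lt|lt|/val_inj //] := ltngtP a c; first exact: W.
  by apply/esym; apply: W.
move=> E; suff: #|[set x in O | c < x]| < #|[set x in O | a < x]| by rewrite E ltnn.
apply: proper_card; apply/properP; split.
  by apply/subsetP => x; rewrite !inE => /andP[-> /(ltn_trans lt_ac)->].
by exists c; rewrite !inE ?ltnn ?cO ?andbF.
Qed.

Lemma ex_card_above (O : {set 'I_N}) l :
  l < #|O| -> exists2 p, p \in O & #|[set x in O | p < x]| = l.
Proof.
move: {2}#|O| (erefl #|O|) => k; elim: k O => [|k IH] O kO ltl.
  by rewrite kO in ltl.
have [i0 i0O] : exists i0, i0 \in O by apply/card_gt0P; rewrite kO.
have [p pO pmin] : exists2 p, p \in O & forall x, x \in O -> p <= x.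
  by case: (@arg_minnP _ i0 (mem O) (@nat_of_ord N) i0O) => p; exists p.
have kO' : #|O :\ p| = k by have := cardsD1 p O; rewrite pO kO => -[].
have [ltlk|gelk] := ltnP l k.
  have [x xO xl] := IH (O :\ p) kO' ltac:(by rewrite kO').
  move: xO; rewrite in_setD1 => /andP[_ xO]; exists x => //.
  rewrite -{}xl; apply: eq_card => y; rewrite !inE.
  by case: eqP => //= ->; rewrite ltnNge pmin ?andbF.
exists p => //; have -> : l = k by lia.
rewrite -kO'; apply: eq_card => y; rewrite !inE andbC.
have [yO|] := boolP (y \in O); rewrite ?andbF ?andbT //.
by have := pmin y yO; rewrite leq_eqVlt eq_sym -val_eqE /=; lia.
Qed.

Lemma crossersE f i : matching f -> f i < i ->
  crossers f i = [set x in [set x : 'I_N | x < i <= f x] | f i < x].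
Proof.
move=> [fK fN] fi; apply/setP => x; rewrite !inE.
have [->|xi] := eqVneq x (f i); first by rewrite ltnn /= andbF.
have : f x != i by apply: contra_neq xi => <-.
by rewrite -val_eqE /=; lia.
Qed.

(** By induction on closers from left to right: the chords closed before [i]
    agree, hence so does the set of points still open at [i], and the label
    selects the partner of [i] in that set by its rank from the right. *)
Lemma letter_inj f g : matching f -> matching g ->
  letter f =1 letter g -> f =1 g.
Proof.
move=> mf mg E; have [fK fN] := mf; have [gK gN] := mg.
have closer i : (f i < i) = (g i < i).
  by move: (E i); rewrite /letter; case: ifP; case: ifP.
suff main i : f i < i -> g i = f i.
  move=> i; have [/main->//|le] := ltnP (f i) i.
  have lt : f (f i) < f i by rewrite fK ltn_neqAle le andbT eq_sym; exact: fN.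
  by have e := main _ lt; rewrite fK in e; rewrite -{2}e gK.
have [k] := ubnP (nat_of_ord i); elim: k i => // k IH i ltik fi.
have agree c : c < i -> (f c < i) || (g c < i) -> g c = f c.
  move=> ci /orP[fc|gc].
    have [lt|ge] := ltnP (f c) c; first by apply: IH => //; lia.
    have lt : f (f c) < f c by rewrite fK ltn_neqAle ge andbT eq_sym; exact: fN.
    by have e := IH (f c) ltac:(lia) lt; rewrite fK in e; rewrite -{1}e gK.
  have [lt|ge] := ltnP (f c) c; first by apply: IH => //; lia.
  have lt : g (g c) < g c.
    by rewrite gK ltn_neqAle leqNgt -closer -leqNgt ge andbT eq_sym; exact: gN.
  have lt' : f (g c) < g c by rewrite closer.
  by have e := IH (g c) ltac:(lia) lt'; rewrite gK in e; rewrite {2}e fK.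
have gi : g i < i by rewrite -closer.
have Oeq : [set x : 'I_N | x < i <= f x] = [set x : 'I_N | x < i <= g x].
  apply/setP => x; rewrite !inE; have [xi|//] := ltnP x i => /=.
  have := agree x xi; rewrite !ltnNge.
  by case: (leqP i (f x)) => hf; case: (leqP i (g x)) => hg //= /(_ isT);
    move/(congr1 (@nat_of_ord N)); lia.
apply/esym/(@card_above_inj [set x : 'I_N | x < i <= f x]).
- by rewrite inE fK fi leqnn.
- by rewrite Oeq inE gK gi leqnn.
rewrite {2}Oeq -!crossersE //.
by move: (E i); rewrite /letter fi gi => -[].
Qed.

Fixpoint legal (u : nat) (w : seq (option nat)) : bool :=
  match w with
  | [::] => u == 0
  | None :: w' => legal u.+1 w'
  | Some l :: w' => (l < u) && legal u.-1 w'
  end.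

Lemma enum_ord_drop (T : Type) (h : 'I_N -> T) t (tN : t < N) :
  [seq h i | i <- drop t (enum 'I_N)] =
  h (Ordinal tN) :: [seq h i | i <- drop t.+1 (enum 'I_N)].
Proof.
rewrite (drop_nth (Ordinal tN)) ?size_enum_ord //=; congr (h _ :: _).
by apply: val_inj; rewrite /= nth_enum_ord.
Qed.

(** The matching is built by reading [w]. At stage [t] it is an involution
    whose fixed points below [t] are the chords still open; a closer [Some l]
    is swapped with the fixed point that has [l] fixed points to its right. *)
Lemma legal_letter (w : seq (option nat)) : size w = N -> legal 0 w ->
  exists2 f, matching f & [seq letter f i | i <- enum 'I_N] = w.
Proof.
move=> sw lw.
(* Label of [j] in a partial matching: an open point counts whether it is
   still a fixed point or is already matched to something after [j]. *)
pose plet f j := if f j < j then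
  Some #|[set c : 'I_N | (f j < c < j) && ((f c == c) || (j < f c))]| else None.
pose free f t := [set c : 'I_N | (c < t) && (f c == c)].
have step t : t <= N -> exists f, [/\ involutive f, forall c, t <= c -> f c = c,
    forall j, j < t -> plet f j = nth None w j & legal #|free f t| (drop t w)].
  elim: t => [_|t IH tN].
    exists id; split=> //; rewrite drop0; have -> : free id 0 = set0 by apply/setP.
    by rewrite cards0.
  have [f [fK fid fw flegal]] := IH (ltnW tN); set ot := Ordinal tN.
  have flt c : c < t -> f c < t.
    move=> ct; rewrite ltnNge; apply/negP => h; have := fid _ h.
    by rewrite fK => e; rewrite -e in h; lia.
  have ft : f ot = ot by apply: fid.
  have dw := drop_nth None (leq_trans tN (eq_leq (esym sw))).
  move: flegal; rewrite dw; case E: (nth None w t) => [l|] /=; last first.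
    move=> lg; exists f; split=> // [c ct|j jt|]; first by apply: fid; lia.
      have [->|jot] := eqVneq j ot; first by rewrite /= E /plet ft ltnn.
      by apply: fw; move: jot; rewrite -val_eqE /=; lia.
    have -> : free f t.+1 = ot |: free f t.
      apply/setP => c; rewrite !inE; have [->|] := eqVneq c ot.
        by rewrite ft eqxx ltnSn.
      by rewrite -val_eqE /= ltnS [c <= t]leq_eqVlt => /negPf ->.
    by rewrite cardsU1 inE ltnn.
  move=> /andP[/ex_card_above[p pO pl] lg].
  move: (pO); rewrite inE => /andP[pt /eqP fp].
  pose g c := if c == p then ot else if c == ot then p else f c.
  have pot : p == ot = false by rewrite -val_eqE /=; lia.
  have gp : g p = ot by rewrite /g eqxx.
  have got : g ot = p by rewrite /g eq_sym pot eqxx.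
  have gf c : c != p -> c != ot -> g c = f c by rewrite /g => /negPf-> /negPf->.
  exists g; split.
  - move=> c; have [->|cp] := eqVneq c p; first by rewrite gp.
    have [->|co] := eqVneq c ot; first by rewrite got.
    rewrite [g c]gf // gf ?fK //; first by apply: contra_neq cp => e; rewrite -(fK c) e.
    by apply: contra_neq co => e; rewrite -(fK c) e.
  - move=> c ct; rewrite gf; last by rewrite -val_eqE /=; lia.
      by apply: fid; lia.
    by rewrite -val_eqE /=; lia.
  - move=> j; rewrite ltnS leq_eqVlt => /orP[/eqP jt|jt].
      have -> : j = ot by apply: val_inj.
      rewrite /plet got /= pt E; congr Some; rewrite -pl; apply: eq_card => c.
      rewrite !inE; case: (ltngtP p c) => //= pc; rewrite ?andbF // ?andbT.
      case: (ltnP c t) => //= ct; rewrite gf -?val_eqE /=; try lia.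
      by have := flt c ct; lia.
    rewrite -fw // /plet; have [->|jp] := eqVneq j p.
      by rewrite gp fp ltnn /= ltnNge ltnW.
    have jo : j != ot by rewrite -val_eqE /=; lia.
    rewrite gf //; case: ifP => // fj; congr Some; apply: eq_card => c.
    rewrite !inE; case: (boolP (f j < c < j)) => //= /andP[_ cj].
    have [->|cp] := eqVneq c p; first by rewrite gp fp eqxx /= jt orbT.
    by rewrite gf // -val_eqE /=; lia.
  - suff -> : #|free g t.+1| = #|free f t|.-1 by [].
    rewrite (cardsD1 p (free f t)) pO /=; apply: eq_card => c; rewrite !inE.
    have [->|cp] := eqVneq c p; first by rewrite gp eq_sym pot andbF.
    have [->|co] := eqVneq c ot; first by rewrite got pot /= ltnn andbF.
    rewrite gf //= ltnS leq_eqVlt; move: co; rewrite -val_eqE /= => /negPf-> //.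
have [f [fK fid fw flegal]] := step N (leqnn _).
move: flegal; rewrite drop_oversize ?sw //= cards_eq0 => /eqP /setP free0.
have fN c : f c != c.
  by have := free0 c; rewrite !inE ltn_ord /= => ->.
exists f => //; apply: (@eq_from_nth _ None); first by rewrite size_map size_enum_ord.
move=> i; rewrite size_map size_enum_ord => iN.
rewrite (nth_map (Ordinal iN)) ?size_enum_ord // -(fw (Ordinal iN)) //=.
have -> : nth (Ordinal iN) (enum 'I_N) i = Ordinal iN.
  by apply: val_inj; rewrite /= nth_enum_ord.
rewrite /letter /plet; case: ifP => // _; congr Some; apply: eq_card => c.
by rewrite !inE (negPf (fN c)).
Qed.

End Matchings.

(** * Chord diagrams as fixed-point-free involutions *)

Section Diagrams.
Variable n : nat.
Implicit Types (f : 'I_(2 * n) -> 'I_(2 * n)) (D K : {set {set 'I_(2 * n)}}).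
Implicit Types (i j a c : 'I_(2 * n)).

Definition mate D i : 'I_(2 * n) :=
  odflt i [pick j | (j != i) && ([set i; j] \in D)].

Lemma mateP D : is_chord_diagram D ->
  matching (mate D) /\ D = [set chord (mate D) i | i in 'I_(2 * n)].
Proof.
move=> /andP[/and3P[/eqP covD trivD D0] /forall_inP card2].
have meq (c1 c2 : {set _}) i : c1 \in D -> c2 \in D -> i \in c1 -> i \in c2 -> c1 = c2.
  by move=> c1D c2D i1 i2; rewrite -(def_pblock trivD c1D i1) (def_pblock trivD c2D i2).
have mD i : (mate D i != i) && (chord (mate D) i \in D).
  rewrite /chord /mate; case: pickP => [j|no] //=; exfalso.
  have : i \in cover D by rewrite covD inE.
  move=> /bigcupP[c cD ic]; have /cards2P[x [y [xy cxy]]] := card2 c cD.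
  move: ic; rewrite cxy !inE => /orP[]/eqP ei; subst i.
    by have := no y; rewrite eq_sym xy -cxy cD.
  by have := no x; rewrite xy setUC -cxy cD.
have mN i : mate D i != i by have /andP[] := mD i.
have mC i : chord (mate D) i \in D by have /andP[] := mD i.
split; last first.
  apply/setP => c; apply/idP/imsetP => [cD|[i _ ->]]; last exact: mC.
  have /cards2P[x [y [xy cxy]]] := card2 c cD; exists x => //.
  by apply: (meq _ _ x) => //; rewrite ?cxy /chord !inE eqxx.
split=> // i.
have e : chord (mate D) (mate D i) = chord (mate D) i.
  by apply: (meq _ _ (mate D i)) => //; rewrite /chord !inE eqxx ?orbT.
have : mate D (mate D i) \in chord (mate D) i by rewrite -e /chord !inE eqxx orbT.
by rewrite /chord !inE (negPf (mN _)) orbF => /eqP.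
Qed.

Section Matching.
Variable f : 'I_(2 * n) -> 'I_(2 * n).
Hypothesis mf : matching f.

Let fK : involutive f. Proof. by case: mf. Qed.
Let fN i : f i != i. Proof. by case: mf. Qed.

Definition diagram_of := [set chord f i | i in 'I_(2 * n)].
Local Notation D := diagram_of.

Lemma chordK i : chord f (f i) = chord f i.
Proof. by rewrite /chord fK setUC. Qed.

Lemma mem_chord i c : (c \in chord f i) = (c == i) || (c == f i).
Proof. by rewrite /chord !inE. Qed.

Lemma chord_mem i : i \in chord f i.
Proof. by rewrite mem_chord eqxx. Qed.

Lemma chord_eq c i : c \in chord f i -> chord f c = chord f i.
Proof. by rewrite mem_chord => /orP[]/eqP-> //; rewrite chordK. Qed.

Lemma chord_in i : chord f i \in D.
Proof. exact: imset_f. Qed.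

Lemma matching_diagram : is_chord_diagram D.
Proof.
have card2 i : #|chord f i| = 2 by rewrite cards2 eq_sym fN.
apply/andP; split; last first.
  by apply/forall_inP => c /imsetP[i _ ->]; rewrite card2.
apply/and3P; split.
- apply/eqP/setP => i; rewrite inE; apply/bigcupP; exists (chord f i) => //.
    exact: chord_in.
  exact: chord_mem.
- apply/trivIsetP => c1 c2 /imsetP[i _ ->] /imsetP[j _ ->].
  apply: contraR => /pred0Pn[x /= /andP[xi xj]].
  by rewrite -(chord_eq xi) (chord_eq xj).
- by apply/negP => /imsetP[i _ e]; have := card2 i; rewrite -e cards0.
Qed.

Lemma opener_ltn i : (i < f i) = ~~ (f i < i).
Proof. by have := fN i; rewrite -val_eqE /=; lia. Qed.

Lemma set2_ltn_inj (a b c d : 'I_(2 * n)) : a < b -> c < d ->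
  [set a; b] = [set c; d] -> a = c /\ b = d.
Proof.
move=> ab cd /setP e.
have := e a; have := e b; rewrite !inE !eqxx orbT /=.
have := e c; have := e d; rewrite !inE !eqxx orbT /=.
by rewrite -!val_eqE /= => h1 h2 h3 h4; split; apply: val_inj => /=; lia.
Qed.

Lemma crosses_opener a c : crosses f a c -> a < f a /\ c < f c.
Proof. by rewrite /crosses => /and3P[*]; split; lia. Qed.

Lemma cross_chord a c : a < f a -> c < f c ->
  cross (chord f a) (chord f c) = crosses f a c || crosses f c a.
Proof.
move=> af cf; apply/idP/idP.
  move=> /existsP[a' /existsP[b' /existsP[c' /existsP[d']]]].
  move=> /and5P[/eqP e1 /eqP e2 l1 l2].
  have [<- <-] := set2_ltn_inj af l1 e1; have [<- <-] := set2_ltn_inj cf l2 e2.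
  by [].
move=> h; apply/existsP; exists a; apply/existsP; exists (f a).
apply/existsP; exists c; apply/existsP; exists (f c).
by rewrite /chord !eqxx af cf.
Qed.

Lemma chord_opener i : exists2 a : 'I_(2 * n), a < f a & chord f i = chord f a.
Proof.
have [lt|ge] := boolP (i < f i); first by exists i.
by exists (f i); rewrite ?chordK // fK; move: ge; rewrite opener_ltn negbK.
Qed.

Lemma cross_sym : symmetric (@cross n).
Proof.
move=> c1 c2; apply/idP/idP => /existsP[a /existsP[b /existsP[c /existsP[d]]]];
  move=> /and5P[e1 e2 l1 l2 l];
  apply/existsP; exists c; apply/existsP; exists d;
  apply/existsP; exists a; apply/existsP; exists b;
  by rewrite e1 e2 l1 l2 orbC.
Qed.

Lemma sum_crossers (X : {set 'I_(2 * n)}) :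
  (forall i, i \in X -> f i \in X) ->
  \sum_(i in X | f i < i) #|crossers f i|
    = #|[set p : 'I_(2 * n) * 'I_(2 * n) | (p.1 \in X) && crosses f p.1 p.2]|.
Proof.
move=> Xf; rewrite -sum1_card.
rewrite (partition_big (fun p => f p.1) (fun i => (i \in X) && (f i < i))) /=; last first.
  move=> [a c] /=; rewrite inE /= => /andP[aX h]; rewrite Xf //= fK.
  by have [] := crosses_opener h.
apply: eq_bigr => i /andP[iX fi]; rewrite sum1_card.
have -> : #|crossers f i| = #|[set (f i, c) | c in crossers f i]|.
  by rewrite card_imset // => x y [].
apply: eq_card => -[a c]. rewrite [RHS]unfold_in /= inE /=; apply/imsetP/idP.
  move=> [c' h [-> ->]]; move: h; rewrite inE /crosses fK eqxx Xf //=.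
  by move=> /andP[/andP[-> ->] ->].
move=> /andP[/andP[aX h] /eqP e]; exists c; last by rewrite -e fK.
by move: h; rewrite -e inE /crosses fK => /and3P[-> -> ->].
Qed.

(** Each crossing is charged to the closer of the chord that closes first. *)
Lemma crossings_sum : crossings D = \sum_(i | f i < i) #|crossers f i|.
Proof.
have := @sum_crossers setT (fun i _ => in_setT _).
rewrite (eq_bigl (fun i => f i < i)); last by move=> i; rewrite inE.
move=> ->; rewrite /crossings.
set P := (X in _ = #|X|).
pose h (p : 'I_(2 * n) * 'I_(2 * n)) := [set chord f p.1; chord f p.2].
have hinj : {in P &, injective h}.
  move=> [a c] [a' c']; rewrite !inE /= => h1 h2.
  have [af cf] := crosses_opener h1; have [af' cf'] := crosses_opener h2.
  have inj (x y : 'I_(2 * n)) : x < f x -> y < f y -> chord f x = chord f y -> x = y.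
    by move=> hx hy /set2_ltn_inj[].
  move=> e.
  have ac : a < c by case/and3P: h1.
  have := set21 (chord f a) (chord f c); have := set22 (chord f a) (chord f c).
  rewrite [[set chord f a; _]]e => /set2P[] e2 /set2P[] e1.
  - by move: ac; rewrite (inj _ _ af af' e1) (inj _ _ cf af' e2) ltnn.
  - move: h1 h2; rewrite (inj _ _ af cf' e1) (inj _ _ cf af' e2) /crosses.
    by move=> /and3P[u1 _ _] /and3P[u2 _ _]; lia.
  - by rewrite (inj _ _ af af' e1) (inj _ _ cf cf' e2).
  - by move: ac; rewrite (inj _ _ af cf' e1) (inj _ _ cf cf' e2) ltnn.
rewrite -(card_in_imset hinj); congr #|pred_of_set _|; apply/setP => s.
apply/imset2P/imsetP.
  move=> [c1 c2 /imsetP[i _ ->]]; rewrite inE => /andP[/imsetP[j _ ->]] /= + ->.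
  have [a af ->] := chord_opener i; have [c cf ->] := chord_opener j.
  rewrite cross_chord // => /orP[h1|h1].
    by exists (a, c); rewrite ?inE.
  by exists (c, a); rewrite ?inE //= /h /= setUC.
move=> [[a c]]; rewrite !inE /= => h1 ->.
have [af cf] := crosses_opener h1.
exists (chord f a) (chord f c); rewrite ?inE ?chord_in //.
by rewrite cross_chord ?h1.
Qed.

End Matching.
End Diagrams.

(** * Components *)

(** Grow a set from [x0] one vertex at a time: each new vertex brings an edge.
    [R] is an orientation, so that an edge contributes one pair and not two. *)
Lemma connected_edges (T : finType) (R : rel T) (K : {set T}) (x0 : T) :
  x0 \in K ->
  (forall S : {set T}, S \proper K -> x0 \in S ->
     exists x y, [/\ x \in S, y \in K :\: S & R x y || R y x]) ->
  #|K|.-1 <= #|[set p in setX K K | R p.1 p.2]|.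
Proof.
move=> x0K grow.
have main j : j < #|K| -> exists S : {set T}, [/\ S \subset K, x0 \in S, #|S| = j.+1 &
    j <= #|[set p in setX S S | R p.1 p.2]|].
  elim: j => [_|j IH ltj].
    by exists [set x0]; rewrite sub1set x0K inE eqxx cards1.
  have [S [SK x0S cS jS]] := IH (ltnW ltj).
  have SpK : S \proper K by rewrite properEcard SK cS.
  have [x [y [xS]]] := grow S SpK x0S; rewrite inE => /andP[yS yK] Rxy.
  exists (y |: S); split.
  - by rewrite subUset sub1set yK.
  - by rewrite inE x0S orbT.
  - by rewrite cardsU1 yS cS.
  apply: leq_ltn_trans jS _.
  apply: proper_card; apply/properP; split.
    apply/subsetP => -[u v]; rewrite !inE /= => /andP[/andP[-> ->] ->].
    by rewrite !orbT.
  case/orP: Rxy => Rxy; [exists (x, y) | exists (y, x)];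
    by rewrite !inE /= ?eqxx ?xS ?Rxy ?orbT //= (negPf yS) ?andbF.
have [K0|K0] := posnP #|K|; first by rewrite K0.
have [|S [SK _ cS]] := main #|K|.-1; first by lia.
suff -> : S = K by [].
by apply/eqP; rewrite eqEcard SK cS; lia.
Qed.

Section Component.
Variable n : nat.
Variable f : 'I_(2 * n) -> 'I_(2 * n).
Hypothesis mf : matching f.
Variable K : {set {set 'I_(2 * n)}}.
Hypothesis KD : K \in components (diagram_of f).
Implicit Types (i j a c x y : 'I_(2 * n)).

Let fK : involutive f. Proof. by case: mf. Qed.
Let fN i : f i != i. Proof. by case: mf. Qed.

Definition points_of : {set 'I_(2 * n)} := [set i | chord f i \in K].
Local Notation X := points_of.

Lemma points_mate i : i \in X -> f i \in X.
Proof. by rewrite !inE chordK. Qed.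

Lemma crosses_adj a c : crosses f a c ->
  chord_adj (diagram_of f) (chord f a) (chord f c).
Proof.
move=> h; have [af cf] := crosses_opener h.
by rewrite /chord_adj !chord_in cross_chord // h.
Qed.

Lemma chord_adj_sym : symmetric (chord_adj (diagram_of f)).
Proof. by move=> c1 c2; rewrite /chord_adj cross_sym andbCA. Qed.

Lemma points_cross a c : crosses f a c -> (a \in X) = (c \in X).
Proof.
move=> h; have adj := crosses_adj h.
case/imsetP: KD => c0 c0D KE; rewrite !inE KE !inE !chord_in /=.
apply: same_connect_r; last exact: connect1.
exact/sym_connect_sym/chord_adj_sym.
Qed.

Lemma adj_crosses (c1 c2 : {set 'I_(2 * n)}) : chord_adj (diagram_of f) c1 c2 ->
  exists a c, [/\ c1 = chord f a, c2 = chord f c & crosses f a c || crosses f c a].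
Proof.
move=> /and3P[/imsetP[i _ ->] /imsetP[j _ ->]].
have [a af ->] := chord_opener mf i; have [c cf ->] := chord_opener mf j.
by rewrite cross_chord // => h; exists a, c.
Qed.

(** An uncrossed chord has two sides, and moving along crossings never changes
    side: if one end of a chord lies strictly inside then so does the other,
    and a chord crossing it has an end between them. *)
Lemma points_same_side a x y : a < f a -> a \notin X -> x \in X -> y \in X ->
  a < x < f a -> a < y < f a.
Proof.
move=> af aX xX yX ax.
pose inside (s : {set 'I_(2 * n)}) := [forall z in s, a < z < f a].
have insideE z : z \in X -> inside (chord f z) = (a < z < f a).
  move=> zX; apply/forall_inP/idP => [h|az u]; first exact/h/chord_mem.
  rewrite mem_chord => /orP[]/eqP->//.
  have fza : f z != a by apply: contraNneq aX => <-; apply: points_mate.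
  have zfa : f z != f a by rewrite (inj_eq (can_inj fK)); apply: contraNneq aX => <-.
  move: fza zfa; rewrite -!val_eqE /= => h1 h2.
  case: (boolP (crosses f a z)) => [/points_cross h|]; first by rewrite h zX in aX.
  case: (boolP (crosses f (f z) a)) => [/points_cross h|].
    by rewrite -h (points_mate zX) in aX.
  by rewrite /crosses fK; lia.
have [c0 c0D KE] := imsetP KD.
have side z : z \in X -> (c0 \in K) /\ (inside c0) = (a < z < f a).
  move=> zX; split; first by rewrite KE inE c0D connect0.
  rewrite -insideE //.
  pose P := [pred s | (s \in K) && inside s].
  have stepP s t : chord_adj (diagram_of f) s t -> s \in P -> t \in P.
    move=> st; have [u [v [-> -> uv]]] := adj_crosses st.
    rewrite !inE => /andP[uK]; have uX : u \in X by rewrite inE.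
    have vX : v \in X.
      by case/orP: uv => /points_cross e; [rewrite -e | rewrite e].
    have -> : chord f v \in K by rewrite inE in vX.
    move=> iu; move: (iu); rewrite -chordK // insideE ?points_mate // => fuin.
    move: iu; rewrite insideE // => uin; case/orP: uv => /and3P[h1 h2 h3].
      by rewrite insideE //=; lia.
    by rewrite -chordK // insideE ?points_mate //=; lia.
  have clP : closed (chord_adj (diagram_of f)) P.
    move=> s t st; apply/idP/idP; apply: stepP => //.
    by rewrite chord_adj_sym.
  have c0z : connect (chord_adj (diagram_of f)) c0 (chord f z).
    by move: zX; rewrite inE KE inE => /andP[].
  have := closed_connect clP c0z; rewrite !inE.
  by rewrite inE in zX; rewrite zX KE inE c0D connect0.
have [_ <-] := side y yX; have [_ ->] := side x xX; exact: ax.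
Qed.

Lemma card_points : #|X| = 2 * #|K|.
Proof.
have -> : X = cover K.
  apply/setP => i; rewrite inE; apply/idP/bigcupP => [h|[c cK ic]].
    by exists (chord f i) => //; apply: chord_mem.
  have [c0 c0D KE] := imsetP KD.
  have : c \in diagram_of f by move: cK; rewrite KE inE => /andP[].
  by case/imsetP => j _ cj; rewrite cj in ic cK; rewrite (chord_eq mf ic).
have /andP[/and3P[_ tD _] /forall_inP c2] := matching_diagram mf.
have KsD : K \subset diagram_of f.
  have [c0 c0D ->] := imsetP KD.
  by apply/subsetP => c; rewrite inE => /andP[].
have /eqP <- := trivIsetS KsD tD.
rewrite (eq_bigr (fun _ => 2)); first by rewrite sum_nat_const mulnC.
by move=> c cK; apply/eqP/c2/(subsetP KsD).
Qed.

Lemma component_labels :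
  #|K|.-1 <= \sum_(i in X | f i < i) #|crossers f i|.
Proof.
rewrite (sum_crossers mf points_mate).
have [c0 c0D KE] := imsetP KD.
pose R (c1 c2 : {set 'I_(2 * n)}) :=
  [exists a, exists c, [&& c1 == chord f a, c2 == chord f c & crosses f a c]].
have c0K : c0 \in K by rewrite KE inE c0D connect0.
have adjR s t : chord_adj (diagram_of f) s t -> R s t || R t s.
  move=> /adj_crosses[a [c [-> -> /orP[h|h]]]]; apply/orP; [left|right].
    by apply/existsP; exists a; apply/existsP; exists c; rewrite !eqxx.
  by apply/existsP; exists c; apply/existsP; exists a; rewrite !eqxx.
apply: leq_trans (connected_edges (R := R) c0K _) _.
  move=> S SK c0S.
  have [/exists_inP[s sS /exists_inP[t tKS st]]|no] :=
    boolP [exists s in S, exists t in K :\: S, chord_adj (diagram_of f) s t].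
    by exists s, t; rewrite adjR.
  have noE s t : chord_adj (diagram_of f) s t -> s \in S -> t \in S.
    move=> st sS; apply: contraNT no => tS.
    apply/exists_inP; exists s => //; apply/exists_inP; exists t => //.
    rewrite inE tS /=; have := subsetP (proper_sub SK) s sS.
    rewrite KE !inE => /andP[_ h]; rewrite (connect_trans h (connect1 st)).
    by case/and3P: st => _ ->.
  have clS : closed (chord_adj (diagram_of f)) S.
    move=> s t st; apply/idP/idP; apply: noE => //.
    by rewrite chord_adj_sym.
  case/properP: SK => _ [t tK /negP[]].
  have : connect (chord_adj (diagram_of f)) c0 t by move: tK; rewrite KE inE => /andP[].
  by move=> /(closed_connect clS) <-.
pose h (p : 'I_(2 * n) * 'I_(2 * n)) := (chord f p.1, chord f p.2).
apply: leq_trans (leq_imset_card h _); apply: subset_leq_card.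
apply/subsetP => -[c1 c2]; rewrite !inE /= => /andP[/andP[c1K c2K]].
move=> /existsP[a /existsP[c /and3P[/eqP e1 /eqP e2 ac]]].
by apply/imsetP; exists (a, c); rewrite ?inE /= -?e1 ?c1K // /h /= e1 e2.
Qed.

End Component.

(** * The two-coloured code of a diagram with a marked component *)

Definition cletter := (bool * option nat)%type.

(** The automaton reads a word in which [true] marks the points of the chosen
    component. This is its behaviour after the last red point, with [u] blue
    chords open. *)
Fixpoint accept_after u (w : seq cletter) : bool :=
  match w with
  | [::] => u == 0
  | (false, None) :: w' => accept_after u.+1 w'
  | (false, Some l) :: w' => (l < u) && accept_after u.-1 w'
  | (true, _) :: _ => false
  end.

(** Between the first and the last red point: [s] red points are still to come,
    [r] red chords are open, [b] blue chords opened since the last red point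
    are open, and the [u] blue chords opened before the first red point cannot be
    closed. A red point requires [b = 0], since a blue chord separates no two
    red points. *)
Fixpoint accept_during s u r b (w : seq cletter) : bool :=
  if s is s'.+1 then
    match w with
    | [::] => false
    | (false, None) :: w' => accept_during s u r b.+1 w'
    | (false, Some l) :: w' => (l < b) && accept_during s u r b.-1 w'
    | (true, None) :: w' => (b == 0) && accept_during s' u r.+1 0 w'
    | (true, Some l) :: w' => [&& b == 0, l < r & accept_during s' u r.-1 0 w']
    end
  else accept_after u w.

Fixpoint accept s u (w : seq cletter) : bool :=
  match w with
  | [::] => false
  | (false, None) :: w' => accept s u.+1 w'
  | (false, Some l) :: w' => (l < u) && accept s u.-1 w'
  | (true, _) :: _ => accept_during s u 0 0 w
  end.

Lemma accept_during0 u r b w : accept_during 0 u r b w = accept_after u w.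
Proof. by case: w. Qed.

Section ColouredCode.
Variable N : nat.
Variable f : 'I_N -> 'I_N.
Hypothesis mf : matching f.
Implicit Types (i j a c x y : 'I_N) (Q : {set 'I_N}).

Let fK : involutive f. Proof. by case: mf. Qed.
Let fN i : f i != i. Proof. by case: mf. Qed.

(** The points of a union of connected components. The automaton uses three of
    them: red chords, blue chords between the first and the last red point,
    and the other blue chords. *)
Definition saturated Q :=
  (forall i, i \in Q -> f i \in Q) /\
  (forall a c, crosses f a c -> (a \in Q) = (c \in Q)).

Definition open_count Q t := #|[set c in Q | c < t <= f c]|.

Definition coloured_code (X : {set 'I_N}) t : seq cletter :=
  [seq (i \in X, letter f i) | i <- drop t (enum 'I_N)].

Lemma saturated_mate Q i : saturated Q -> (f i \in Q) = (i \in Q).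
Proof. by case=> Qf _; apply/idP/idP => /Qf //; rewrite fK. Qed.

(** The hypothesis on [Q] makes the two ends of a chord open and close the same
    counter. *)
Lemma open_countS Q (t : 'I_N) : saturated Q ->
  open_count Q (nat_of_ord t).+1 = if t \in Q then
    (if f t < t then (open_count Q t).-1 else (open_count Q t).+1) else open_count Q t.
Proof.
move=> sQ; have ftQ := saturated_mate t sQ.
have fne c : f c = t :> nat -> c = f t by move/val_inj <-; rewrite fK.
have ftt : f t <> t :> nat by move/val_inj/eqP; rewrite (negPf (fN t)).
have [tQ|tQ] := boolP (t \in Q); last first.
  apply: eq_card => c; rewrite !inE; have [cQ|//] := boolP (c \in Q) => /=.
  have ct : c <> t :> nat by move/val_inj => e; rewrite -e cQ in tQ.
  have fct : f c <> t :> nat by move/fne => e; rewrite e ftQ (negPf tQ) in cQ.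
  by lia.
case: ifP => [lt|/negbT ge].
  rewrite /open_count (cardsD1 (f t) [set c in Q | c < t <= f c]).
  rewrite inE ftQ tQ fK lt leqnn /=; apply: eq_card => c; rewrite !inE.
  have [->|cft] := eqVneq c (f t); first by rewrite fK ltnn !andbF.
  have [cQ|//] := boolP (c \in Q) => /=.
  have fct : f c <> t :> nat by move/fne => e; rewrite e eqxx in cft.
  have [->|] := eqVneq c t; first by lia.
  by rewrite -val_eqE /=; lia.
rewrite /open_count; have -> : [set c in Q | c < t.+1 <= f c] = t |: [set c in Q | c < t <= f c].
  apply/setP => c; rewrite !inE; have [->|ct] := eqVneq c t; first by rewrite tQ /=; lia.
  have [cQ|//] := boolP (c \in Q) => /=; rewrite -val_eqE /= in ct.
  have fct : f c = t :> nat -> t <= c by move/fne ->; lia.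
  by lia.
by rewrite cardsU1 inE ltnn andbF.
Qed.

(** The chords counted by the label of [t] cross the chord of [t], so they belong
    to [Q]; the chord of [t] itself makes the inequality strict. *)
Lemma crossers_lt_open Q (t : 'I_N) : saturated Q -> t \in Q -> f t < t ->
  #|crossers f t| < open_count Q t.
Proof.
move=> sQ tQ ft; have [Qf Qx] := sQ.
rewrite /open_count (cardsD1 (f t) [set c in Q | c < t <= f c]) inE Qf // ft fK leqnn /= ltnS.
apply: subset_leq_card; apply/subsetP => c; rewrite !inE => /andP[/andP[h1 h2] h3].
rewrite -(Qx (f t)) ?Qf //= ?h2 ?(ltnW h3) ?andbT; last by rewrite /crosses fK h1 h2.
by rewrite -val_eqE /= neq_ltn h1 orbT.
Qed.

Variable X : {set 'I_N}.
Hypothesis satX : saturated X.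
Hypothesis sideX : forall a x y, a < f a -> a \notin X -> x \in X -> y \in X ->
  a < x < f a -> a < y < f a.
Variables (p0 p1 : 'I_N).
Hypotheses (p0X : p0 \in X) (p1X : p1 \in X).
Hypotheses (minp : forall i, i \in X -> p0 <= i) (maxp : forall i, i \in X -> i <= p1).

Let Y := [set i | (i \notin X) && (p0 < i < p1)].
Let Z := [set i | (i \notin X) && ~~ (p0 < i < p1)].

Let opposite a x : a < f a -> a \notin X -> x \in X -> a < x < f a ->
  (a < p0 < f a) && (a < p1 < f a).
Proof. by move=> h1 h2 h3 h4; rewrite !(sideX h1 h2 h3 _ h4). Qed.

Let ne_mem i x : i \notin X -> x \in X -> i <> x :> nat.
Proof. by move=> iX xX /val_inj e; rewrite e xX in iX. Qed.

Let satYZ : saturated Y /\ saturated Z.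
Proof.
have mX i : (f i \in X) = (i \in X) by apply: saturated_mate.
have inner i : i \notin X -> (p0 < f i < p1) = (p0 < i < p1).
  suff h j : j < f j -> j \notin X -> (p0 < f j < p1) = (p0 < j < p1).
    move=> iX; have [lt|ge] := ltnP i (f i); first exact: h.
    have := h (f i); rewrite fK mX => <- //.
    by rewrite ltn_neqAle ge andbT; apply: fN.
  move=> lt jX; have fjX : f j \notin X by rewrite mX.
  have := ne_mem jX p0X; have := ne_mem jX p1X.
  have := ne_mem fjX p0X; have := ne_mem fjX p1X.
  have := opposite lt jX p0X; have := opposite lt jX p1X.
  by lia.
have crossin a c : crosses f a c -> a \notin X -> c \notin X ->
    (p0 < a < p1) = (p0 < c < p1).
  move=> /and3P[h1 h2 h3] aX cX; have := inner a aX; have := inner c cX.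
  by have := ne_mem aX p0X; have := ne_mem cX p1X; lia.
have [_ Xx] := satX.
split; split.
- by move=> i; rewrite !inE mX => /andP[iX]; rewrite inner // iX.
- move=> a c ac; rewrite !inE (Xx a c) //.
  by have [//|cX] := boolP (c \in X); rewrite (@crossin a c) // (Xx a c).
- by move=> i; rewrite !inE mX => /andP[iX]; rewrite inner // iX.
- move=> a c ac; rewrite !inE (Xx a c) //.
  by have [//|cX] := boolP (c \in X); rewrite (@crossin a c) // (Xx a c).
Qed.

Let satY : saturated Y. Proof. by case: satYZ. Qed.
Let satZ : saturated Z. Proof. by case: satYZ. Qed.

Let open_count_end Q : open_count Q N = 0.
Proof.
apply/eqP; rewrite cards_eq0; apply/eqP/setP => c; rewrite !inE.
by apply/negP => /andP[_ /andP[_]]; rewrite leqNgt ltn_ord.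
Qed.

Let code_end : coloured_code X N = [::].
Proof. by rewrite /coloured_code drop_oversize ?size_enum_ord. Qed.

Let codeE t (tN : t < N) : coloured_code X t =
  (Ordinal tN \in X, letter f (Ordinal tN)) :: coloured_code X t.+1.
Proof. exact: (enum_ord_drop (fun i => (i \in X, letter f i)) tN). Qed.

Let rem t := #|[set i in X | t <= i]|.

Let remS (t : 'I_N) : rem t = (t \in X) + rem t.+1.
Proof.
rewrite /rem (cardsD1 t) inE leqnn andbT; congr (_ + _); apply: eq_card => c.
by rewrite !inE ltn_neqAle andbA [_ && (c \in X)]andbC eq_sym andbA.
Qed.

Let rem_gt0 t : (0 < rem t) = (t <= p1).
Proof.
apply/card_gt0P/idP => [[i]|tp]; last by exists p1; rewrite inE p1X.
by rewrite inE => /andP[/maxp ip /leq_trans]; apply.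
Qed.

(** A blue chord still open at the red point [t] and opened after the first red
    point would separate the two. *)
Let inner_closed (t : 'I_N) : t \in X -> open_count Y t = 0.
Proof.
move=> tX; apply/eqP; rewrite cards_eq0; apply/eqP/setP => c; rewrite !inE.
apply/negP => /andP[/andP[cX cin] /andP[ct tf]].
have fcX : f c \notin X by rewrite saturated_mate.
have := ne_mem fcX tX; move=> h.
have : c < t < f c by lia.
move/(opposite (leq_trans ct tf) cX tX); by lia.
Qed.

Lemma accept_during_code t : p0 <= t <= N ->
  accept_during (rem t) (open_count Z t) (open_count X t) (open_count Y t) (coloured_code X t).
Proof.
move=> /andP[]; move: {2}(N - t) (erefl (N - t)) => k; elim: k t => [|k IH] t kt pt tN.
  have -> : t = N by lia.
  have -> : rem N = 0 by apply/eqP; rewrite -leqn0 leqNgt rem_gt0 -ltnNge.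
  by rewrite code_end !open_count_end.
have tN' : t < N by lia.
have := IH t.+1 ltac:(lia) ltac:(lia) tN'; rewrite (codeE tN').
set ot := Ordinal tN'; have et : t = ot by [].
rewrite (open_countS ot satZ) (open_countS ot satY) (open_countS ot satX).
have := remS ot; rewrite -et => ->.
have [otX|otX] := boolP (ot \in X).
  have -> : (ot \in Z) = false by rewrite inE otX.
  have -> : (ot \in Y) = false by rewrite inE otX.
  rewrite /= (inner_closed otX) /letter; have := crossers_lt_open satX otX.
  by case: ifP => // _ /(_ isT) /= ->.
have [tp|tp] := leqP t p1.
  have tin : p0 < t < p1.
    have := ne_mem otX p0X; have := ne_mem otX p1X; rewrite -et; lia.
  have otY : ot \in Y by rewrite inE otX.
  have -> : (ot \in Z) = false by rewrite inE otX -et tin.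
  rewrite otY add0n; have : 0 < rem t.+1 by rewrite rem_gt0; lia.
  case: (rem t.+1) => // s _; rewrite /letter /=; have := crossers_lt_open satY otY.
  by case: ifP => // _ /(_ isT) /= ->.
have otZ : ot \in Z by rewrite inE otX -et; lia.
have -> : rem t.+1 = 0 by apply/eqP; rewrite -leqn0 leqNgt rem_gt0; lia.
rewrite otZ /letter !accept_during0 /=; have := crossers_lt_open satZ otZ.
by case: ifP => // _ /(_ isT) /= ->.
Qed.

Lemma accept_code : accept #|X| 0 (coloured_code X 0).
Proof.
suff main k t : t <= p0 -> p0 - t = k -> accept #|X| (open_count Z t) (coloured_code X t).
  suff e : open_count Z 0 = 0; first by have := main p0 0; rewrite e; apply; rewrite ?subn0.
  by apply/eqP; rewrite cards_eq0; apply/eqP/setP => c; rewrite !inE andbF.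
elim: k t => [|k IH] t tp kt.
  have -> : t = p0 by lia.
  have := @accept_during_code p0; rewrite leqnn ltnW // => /(_ isT).
  have -> : rem p0 = #|X|.
    by apply: eq_card => i; rewrite inE; case: (boolP (i \in X)) => // /minp.
  rewrite inner_closed //.
  have -> : open_count X p0 = 0.
    apply/eqP; rewrite cards_eq0; apply/eqP/setP => c; rewrite !inE.
    by apply/negP => /andP[/minp h /andP[h' _]]; lia.
  rewrite codeE; case: (boolP (_ \in X)) => // /negP[].
  by rewrite (_ : Ordinal _ = p0) //; apply: val_inj.
have tN : t < N by apply: leq_ltn_trans tp _.
have := IH t.+1 ltac:(lia) ltac:(lia); rewrite (codeE tN).
set ot := Ordinal tN; have et : t = ot by [].
have otX : ot \notin X by apply/negP => /minp; rewrite -et; lia.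
have otZ : ot \in Z by rewrite inE otX -et; lia.
rewrite (open_countS ot satZ) otZ (negPf otX) /letter /=.
have := crossers_lt_open satZ otZ.
by case: ifP => // _ /(_ isT) /= ->.
Qed.

End ColouredCode.

(** * Enumerating words *)

Fixpoint words (T : Type) (A : seq T) N : seq (seq T) :=
  if N is N'.+1 then [seq a :: w | a <- A, w <- words A N'] else [:: [::]].

Lemma wordsS (T : Type) (A : seq T) N :
  words A N.+1 = [seq a :: w | a <- A, w <- words A N].
Proof. by []. Qed.

Lemma mem_words (T : eqType) (A : seq T) N w :
  (w \in words A N) = (size w == N) && all [in A] w.
Proof.
elim: N w => [|N IH] [|a w] //=.
  by apply/allpairsP => -[[b v] []].
rewrite eqSS andbCA -IH; apply/allpairsP/andP => [[[b v] [/= ? ?] [-> ->]]|[? ?]] //.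
by exists (a, w).
Qed.

Lemma uniq_words (T : eqType) (A : seq T) N : uniq A -> uniq (words A N).
Proof.
move=> uA; elim: N => //= N IH; apply: allpairs_uniq => // -[a w] [b v] _ _ /=.
by case=> -> ->.
Qed.

Definition letters M : seq cletter :=
  [seq (c, o) | c <- [:: true; false], o <- None :: map Some (iota 0 M)].

Lemma uniq_letters M : uniq (letters M).
Proof.
apply: allpairs_uniq => //; last by move=> [? ?] [? ?] _ _ /= [-> ->].
rewrite /= map_inj_uniq ?iota_uniq ?andbT; last by move=> ? ? [].
by apply/mapP => -[].
Qed.

Lemma mem_letters M c o :
  ((c, o) \in letters M) = (if o is Some l then l < M else true).
Proof.
apply/allpairsP/idP => [[[c' o']] /= [_ + [_ ->]]|].
  by rewrite inE => /orP[/eqP->|/mapP[l + ->]] //; rewrite mem_iota.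
move=> oM; exists (c, o); split=> //=; first by case: c.
by case: o oM => // l lM; rewrite inE map_f // mem_iota.
Qed.

(** * Counting diagrams from below *)

Definition label_sum (w : seq (option nat)) := \sum_(a <- w) odflt 0 a.

Definition plain_letters M : seq (option nat) := None :: map Some (iota 0 M).

Definition legal_count M N u m :=
  \sum_(w <- words (plain_letters M) N) (legal u w && (label_sum w == m)).

Lemma mate_diagram_of n (f : 'I_(2 * n) -> 'I_(2 * n)) :
  matching f -> mate (diagram_of f) =1 f.
Proof.
move=> mf i; have [mm DE] := mateP (matching_diagram mf).
set g := mate _ in mm DE *.
have : chord g i \in diagram_of f by rewrite DE imset_f.
case/imsetP => j _ e.
have ij : i \in chord f j by rewrite -e chord_mem.
have : g i \in chord f i by rewrite (chord_eq mf ij) -e /chord !inE eqxx orbT.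
by case: mm => _ gN; rewrite mem_chord (negPf (gN i)) => /eqP.
Qed.

Lemma legal_count_le M n m : legal_count M (2 * n) 0 m <= #|chord_diagrams n m|.
Proof.
have -> : legal_count M (2 * n) 0 m =
    count (fun w => legal 0 w && (label_sum w == m)) (words (plain_letters M) (2 * n)).
  by rewrite -sum1_count big_mkcond; apply: eq_bigr => w _; case: ifP.
pose code (D : {set {set 'I_(2 * n)}}) := [seq letter (mate D) i | i <- enum 'I_(2 * n)].
rewrite -size_filter cardE -(size_map code); apply: uniq_leq_size.
  apply/filter_uniq/uniq_words; rewrite /= map_inj_uniq ?iota_uniq ?andbT.
    by apply/mapP => -[].
  by move=> ? ? [].
move=> w; rewrite mem_filter mem_words => /andP[/andP[lw /eqP sw] /andP[/eqP szw _]].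
have [f mf fw] := legal_letter szw lw.
have E i : letter (mate (diagram_of f)) i = letter f i.
  have e := mate_diagram_of mf; rewrite /letter e; case: ifP => // _.
  by congr Some; apply: eq_card => c; rewrite !inE !e.
apply/mapP; exists (diagram_of f); last by rewrite -fw; apply: eq_map => i; rewrite E.
rewrite mem_enum inE matching_diagram //= crossings_sum // -sw -fw.
rewrite /label_sum big_map enumT -/(index_enum _) big_mkcond; apply/eqP/eq_bigr => i _.
by rewrite /letter; case: ifP.
Qed.

(** Only labels below [H] are kept among the closing letters: at height [H] or
    more they are all legal, so that path and labels decouple. *)
Lemma legal_countS M H N u m : H <= u -> H <= M ->
  legal_count M N u.+1 m + \sum_(0 <= l < H | l <= m) legal_count M N u.-1 (m - l)
    <= legal_count M N.+1 u m.
Proof.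
move=> Hu HM; rewrite /legal_count wordsS big_allpairs_dep big_cons; apply: leq_add.
  by apply: leq_sum => w _; rewrite /label_sum big_cons add0n.
rewrite big_map; have -> : iota 0 M = index_iota 0 M by rewrite /index_iota subn0.
rewrite (big_cat_nat (n := H)) //=.
apply: leq_trans (leq_addr _ _); rewrite big_mkcond big_nat [leqRHS]big_nat.
apply: leq_sum => l /andP[_ lH]; case: ifP => // lm.
apply: leq_sum => w _; rewrite /label_sum big_cons /= (leq_trans lH Hu) /=.
by case: legal => //=; rewrite -(eqn_add2l l) subnKC.
Qed.

Lemma legal_count_down M h : h <= M -> 0 < legal_count M h h 0.
Proof.
elim: h => [_|h IH hM].
  by rewrite /legal_count /= big_seq1 /label_sum big_nil.
apply: leq_trans (@legal_countS M 1 h h.+1 0 _ _) => //; last by lia.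
by rewrite big_mkcond big_nat1 /= subn0 ltn_addl // IH // ltnW.
Qed.

Lemma legal_count_up M H N m : legal_count M N H m <= legal_count M (H + N) 0 m.
Proof.
suff main h u : u + h = H -> legal_count M N H m <= legal_count M (h + N) u m.
  exact: main.
elim: h u => [|h IH] u; first by rewrite addn0 => ->.
move=> uh; apply: leq_trans (@legal_countS M 0 _ _ _ _ _) => //.
by rewrite big_geq // addn0 IH // -uh addnS addSn.
Qed.

(** Paths with [a] openers and [d] closers from height [d - a] down to [0] that
    never go below [0], by the reflection principle. *)
Definition ballot a d := 'C(a + d, a) - (if a is a'.+1 then 'C(a + d, a') else 0).

Fixpoint bounded_comps H d m :=
  if d is d'.+1 then \sum_(0 <= l < H | l <= m) bounded_comps H d' (m - l)
  else m == 0 : nat.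

Lemma ballot0 d : ballot 0 d = 1. Proof. by rewrite /ballot bin0. Qed.

Lemma ballotS a d : ballot a.+1 d.+1 <= ballot a d.+1 + ballot a.+1 d.
Proof.
rewrite /ballot addSn binS addSnnS.
by case: a => [|a]; rewrite ?bin0 ?binS /=; rewrite ?bin1; lia.
Qed.

Lemma ballot_diag a : ballot a.+1 a = 0.
Proof.
rewrite /ballot addSn -bin_sub; last by lia.
by rewrite (_ : (a + a).+1 - a.+1 = a) ?subnn //; lia.
Qed.

(** A path that stays at height [H] or more until its last [H] closers, with an
    arbitrary choice of labels below [H]; these last closers get label [0]. *)
Lemma ballot_comps_le M H a d m : a <= d -> H <= M ->
  ballot a d * bounded_comps H d m <= legal_count M (a + d + H) (H + (d - a)) m.
Proof.
move=> + HM; move: {2}(a + d) (erefl (a + d)) => s.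
elim: s a d m => [|s IH] a d m ads ad.
  have -> : a = 0 by lia. have -> : d = 0 by lia.
  rewrite ballot0 mul1n subnn !add0n addn0 /=; case: eqP => // ->; exact: legal_count_down.
case: d => [|d] in ads ad *; first by lia.
have closes a' : a' + d = s -> a' <= d ->
    ballot a' d * bounded_comps H d.+1 m <=
    \sum_(0 <= l < H | l <= m) legal_count M (s + H) (H + (d.+1 - a')).-1 (m - l).
  move=> e le; rewrite /= big_distrr /=; apply: leq_sum => l _.
  apply: leq_trans (IH a' d (m - l) e le) _.
  by rewrite e (_ : (H + (d.+1 - a')).-1 = H + (d - a')) //; lia.
rewrite ads addSn; apply: leq_trans (@legal_countS M H _ _ _ _ _) => //; last by lia.
case: a => [|a] in ads ad *.
  have := closes 0 ltac:(lia) ltac:(lia); rewrite !ballot0.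
  by move=> h; apply: leq_trans h (leq_addl _ _).
have := IH a d.+1 m ltac:(lia) ltac:(lia).
rewrite (_ : a + d.+1 = s); last by lia.
rewrite (_ : H + (d.+1 - a) = (H + (d.+1 - a.+1)).+1); last by lia.
move=> hopen.
have hclose : ballot a.+1 d * bounded_comps H d.+1 m <=
    \sum_(0 <= l < H | l <= m) legal_count M (s + H) (H + (d.+1 - a.+1)).-1 (m - l).
  have [lt|ge] := ltnP a d; first by apply: closes; lia.
  by rewrite (_ : d = a) ?ballot_diag //; lia.
apply: leq_trans (leq_add hopen hclose).
by rewrite -mulnDl leq_mul2r ballotS orbT.
Qed.

(** Weak compositions of [m] into [d] parts. *)
Definition weak_comps d m := if d is d'.+1 then 'C(d' + m, m) else m == 0 : nat.

(** Weak compositions of [m] into [d] parts whose first part is at least [H]: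
    subtract [H] from it. *)
Definition large_part_comps H d m := if H <= m then weak_comps d (m - H) else 0.

Lemma weak_compsS d m : weak_comps d.+1 m = weak_comps d m + large_part_comps 1 d.+1 m.
Proof.
rewrite /large_part_comps; case: m => [|m] /=.
  by rewrite !bin0 /=; case: d => [|d] /=; rewrite ?bin0.
rewrite subSS subn0; case: d => [|d] /=; first by rewrite !add0n !binn.
by rewrite addSn binS addSnnS.
Qed.

Lemma weak_comps_split H d m : weak_comps d.+1 m =
  \sum_(0 <= l < H | l <= m) weak_comps d (m - l) + large_part_comps H d.+1 m.
Proof.
elim: H => [|H IH]; first by rewrite big_geq // /large_part_comps subn0.
rewrite {}IH big_mkcond [in RHS]big_mkcond big_nat_recr // -addnA; congr (_ + _).
rewrite /large_part_comps; case: (leqP H m) => [le|lt]; last by rewrite ltnNge ltnW.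
rewrite weak_compsS /large_part_comps subn_gt0; congr (_ + _).
by case: ltnP => // lt; rewrite -subnDA addn1.
Qed.

(** Union bound over the part that reaches [H]. *)
Lemma weak_comps_le H d m :
  weak_comps d m <= bounded_comps H d m + d * large_part_comps H d m.
Proof.
elim: d m => [|d IH] m; first by rewrite /= mul0n addn0.
rewrite (weak_comps_split H) /= mulSn addnCA [leqLHS]addnC leq_add2l.
apply: leq_trans (_ : \sum_(0 <= l < H | l <= m)
    (bounded_comps H d (m - l) + d * large_part_comps H d (m - l)) <= _).
  by apply: leq_sum => l _.
rewrite big_split leq_add2l -big_distrr /= leq_mul //.
rewrite {2}/large_part_comps; case: (leqP H m) => [Hm|Hm].
  rewrite -/(weak_comps d.+1 (m - H)) (weak_comps_split H d (m - H)).
  apply: leq_trans (leq_addr _ _).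
  rewrite big_mkcond [leqRHS]big_mkcond; apply: leq_sum => l _; rewrite /large_part_comps.
  case: ifP => // lm; have [h|h] := leqP H (m - l).
    rewrite (_ : l <= m - H); last by lia.
    by rewrite subnAC.
  by case: ifP => //; lia.
by rewrite big1 // => l _; rewrite /large_part_comps ifN // -ltnNge; lia.
Qed.

(** When there are more parts than units, each further unit at least doubles the
    number of compositions, so a part of size [H] costs a factor [2 ^ H]. *)
Lemma weak_comps_half d m : m < d -> 2 * weak_comps d.+1 m <= weak_comps d.+1 m.+1.
Proof.
move=> md /=; rewrite addnS -(leq_pmul2l (ltn0Sn m)) -mul_bin_diag mulnCA.
by rewrite mulnA leq_mul2r; apply/orP; right; lia.
Qed.

Lemma large_part_comps_half H d m : m <= d ->
  2 ^ H * large_part_comps H d.+1 m <= weak_comps d.+1 m.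
Proof.
rewrite /large_part_comps; case: (leqP H m) => [|_ _]; last by rewrite muln0.
elim: H => [|H IH] Hm md; first by rewrite mul1n subn0.
apply: leq_trans (IH (ltnW Hm) md); rewrite expnS [2 * _]mulnC -mulnA leq_mul2l.
have -> : m - H = (m - H.+1).+1 by lia.
by apply/orP; right; apply: weak_comps_half; lia.
Qed.

Lemma bounded_comps_ge H d m : m < d -> 2 * d <= 2 ^ H ->
  weak_comps d m <= 2 * bounded_comps H d m.
Proof.
case: d => // d md dH; have h1 := weak_comps_le H d.+1 m.
have h2 := @large_part_comps_half H d m md.
have : 2 * d.+1 * large_part_comps H d.+1 m <= weak_comps d.+1 m.
  by apply: leq_trans h2; rewrite leq_mul2r dH orbT.
by rewrite -mulnA; lia.
Qed.

Lemma bin_grow a m j : m <= a.+1 -> 'C(a + j + m, m) <= 2 ^ j * 'C(a + m, m).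
Proof.
move=> ma; elim: j => [|j IH]; first by rewrite addn0 mul1n.
rewrite expnS -mulnA; apply: leq_trans (_ : 2 * 'C(a + j + m, m) <= _); last first.
  by rewrite leq_mul2l IH orbT.
rewrite addnS addSn -(leq_pmul2l (ltn0Sn (a + j))).
have := mul_bin_down (a + j + m).+1 m.
rewrite /= (_ : (a + j + m).+1 - m = (a + j).+1); last by lia.
by move=> <-; rewrite mulnA leq_mul2r; apply/orP; right; lia.
Qed.

Lemma central_bin n : 4 ^ n <= (2 * n).+1 * 'C(n + n, n).
Proof.
elim: n => [|n IH]; first by rewrite bin0.
have e : n.+1 * 'C(n.+1 + n.+1, n.+1) = 2 * ((2 * n).+1 * 'C(n + n, n)).
  have h1 := mul_bin_diag (n + n).+2 n; rewrite /= in h1.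
  have h2 := mul_bin_down (n + n).+1 n; rewrite /= (_ : (n + n).+1 - n = n.+1) in h2; last by lia.
  rewrite addSn addnS -h1; have : n.+1 * 'C((n + n).+1, n) = (n + n).+1 * 'C(n + n, n) by [].
  by nia.
by rewrite expnS; nia.
Qed.

Lemma ballot_central n : n.+1 * ballot n n = 'C(n + n, n).
Proof.
case: n => [|n]; rewrite ?ballot0 // /ballot.
have h := mul_bin_left (n.+1 + n.+1) n.
rewrite (_ : n.+1 + n.+1 - n = n.+2) in h; last by lia.
by rewrite mulnBr -h; lia.
Qed.

(** The mode of a binomial variable with [n + m] trials and success probability
    [m / (n + m)] is [m], and the largest of [n + m + 1] terms is at least their
    average. *)
Lemma binomial_mode n m : 0 < n ->
  (n + m) ^ (n + m) <= (n + m).+1 * ('C(n + m, m) * (n ^ n * m ^ m)).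
Proof.
move=> n0; rewrite expnDn; set N := n + m.
pose t i := 'C(N, i) * (n ^ (N - i) * m ^ i).
have ratio i : i < N -> i.+1 * n * t i.+1 = (N - i) * m * t i.
  move=> iN; rewrite /t expnS (_ : N - i = (N - i.+1).+1); last by lia.
  have := mul_bin_left N i; rewrite (_ : N - i = (N - i.+1).+1); last by lia.
  rewrite [n ^ _.+1]expnS; move: (n ^ _) (m ^ _) => u v e.
  rewrite -!mulnA [n * (_ * _)]mulnCA !mulnA e; lia.
have up i : i < m -> t i <= t i.+1.
  move=> im; have r := ratio i ltac:(lia).
  rewrite -(@leq_pmul2l (i.+1 * n)) ?muln_gt0 // r leq_mul2r; apply/orP; right.
  by rewrite mulnC leq_mul //; lia.
have down i : m <= i -> i < N -> t i.+1 <= t i.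
  move=> mi iN; have r := ratio i iN.
  rewrite -(@leq_pmul2l (i.+1 * n)) ?muln_gt0 // r leq_mul2r; apply/orP; right.
  by rewrite [i.+1 * n]mulnC leq_mul //; lia.
have max i : i <= N -> t i <= t m.
  move=> iN; have [im|mi] := leqP i m.
    elim: (m - i) {-2}i im (erefl (m - i)) => [|k IH] j jm e.
      by rewrite (_ : j = m) //; lia.
    by apply: leq_trans (up j _) (IH j.+1 _ _); lia.
  elim: i iN mi => // i IH iN mi; apply: leq_trans (down i _ _) _ => //.
  have [e|] := eqVneq i m; first by rewrite e.
  by move=> ne; apply: IH; lia.
apply: leq_trans (_ : \sum_(i < N.+1) t m <= _).
  by apply: leq_sum => i _; apply: max; rewrite -ltnS.
by rewrite sum_nat_const card_ord leq_mul2l /t -/N addnK leqnn orbT.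
Qed.

(** The height [H] is logarithmic, so the losses [4 ^ H] and [2 ^ H] incurred on
    paths and labels are polynomial in [n]. *)
Lemma card_chord_diagrams_ge n m H : 0 < H -> 2 * n <= 2 ^ H -> 2 ^ H <= 4 * n ->
  m < n - H ->
  4 ^ n * (n + m) ^ (n + m)
    <= 1024 * n ^ 6 * (n ^ n * m ^ m) * #|chord_diagrams n m|.
Proof.
move=> H0 nH Hn mn; set d := n - H.
have h1 := legal_count_le H n m.
have h2 := @legal_count_up H H (d + d + H) m.
have h3 := @ballot_comps_le H H d d m (leqnn d) (leqnn H).
rewrite subnn addn0 in h3.
rewrite (_ : H + (d + d + H) = 2 * n) in h2; last by rewrite /d; lia.
have h4 := @bounded_comps_ge H d m mn ltac:(rewrite /d; lia).
have h5 : 'C(n + m, m) <= 2 ^ H.+1 * weak_comps d m.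
  have [d' E] : exists d', d = d'.+1 by exists d.-1; lia.
  have nd' : d' + H.+1 = n by move: E; rewrite /d; lia.
  have := @bin_grow d' m H.+1; rewrite nd' E /=; apply.
  by rewrite -E ltnW.
have h6 := central_bin d; have h7 := ballot_central d.
have n0 : 0 < n by lia.
have h8 := binomial_mode m n0.
have d1 : d.+1 <= n by rewrite /d; lia.
have n2 : n + m < 2 * n by lia.
have nE : n = d + H by rewrite /d; lia.
move: h1 h2 h3 h4 h5 h6 h7 h8.
move: (legal_count H (2 * n) 0 m) (legal_count H (d + d + H) H m) => L1 L2.
move: (ballot d d) (bounded_comps H d m) (weak_comps d m) => b c s.
move: #|chord_diagrams n m| 'C(n + m, m) 'C(d + d, d) => W B A.
move: (n ^ n * m ^ m) ((n + m) ^ (n + m)) => v V h1 h2 h3 h4 h5 h6 h7 h8.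
have bcW : b * c <= W by apply: leq_trans h3 (leq_trans h2 h1).
have hB : B <= 8 * n * (2 * c).
  apply: leq_trans h5 _; rewrite leq_mul //.
  by rewrite expnS; lia.
have hb : 4 ^ n <= 16 * n ^ 2 * ((2 * n) * (n * b)).
  rewrite {1}nE expnD mulnC leq_mul //.
    by rewrite -[4]/(2 ^ 2) -expnM mulnC expnM -[16]/(4 ^ 2) -expnMn leq_exp2r.
  by apply: leq_trans h6 _; rewrite -h7 leq_mul //; [lia | rewrite leq_mul2r d1 orbT].
have hV : V <= 2 * n * (B * v) by apply: leq_trans h8 _; rewrite leq_mul2r n2 orbT.
apply: leq_trans (leq_mul hb hV) _.
apply: leq_trans (_ : 16 * n ^ 2 * (2 * n * (n * b)) * (2 * n * (8 * n * (2 * c) * v)) <= _).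
  by rewrite leq_mul2l; apply/orP; right; rewrite leq_mul2l leq_mul2r hB !orbT.
apply: leq_trans (_ : 1024 * n ^ 6 * v * (b * c) <= _); last by rewrite leq_mul2l bcW orbT.
by apply: eq_leq; rewrite !expnS expn0; ring.
Qed.

Import Order.TTheory GRing.Theory Num.Theory.
Local Open Scope ring_scope.

(** * Weights of two-coloured words *)

Lemma big_letters (V : nmodType) M (F : cletter -> V) :
  \sum_(a <- letters M) F a =
    (F (true, None) + \sum_(0 <= l < M) F (true, Some l)) +
    (F (false, None) + \sum_(0 <= l < M) F (false, Some l)).
Proof.
by rewrite big_allpairs /= !big_cons big_nil addr0 !big_map /index_iota subn0.
Qed.

Section Weights.
Variables (R : realFieldType) (q x : R) (M : nat).
Hypotheses (q0 : 0 <= q) (q1 : q <= 1) (x0 : 0 <= x).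

(** A blue opener weighs [1 / 2] and the legal blue closers together at most
    [1 / 2], so the blue steps behave like a fair random walk. For red steps
    both bounds are [x]; taking [x ^ 2 = (1 - q) / 2] gives a red chord with
    label [0] the same weight as a blue one. *)
Definition weight (a : cletter) : R :=
  match a with
  | (false, None) => 2^-1
  | (false, Some l) => 2^-1 * (1 - q) * q ^+ l
  | (true, None) => x
  | (true, Some l) => x * (1 - 2^-1) * 2^-1 ^+ l
  end.

Definition total (acc : seq cletter -> bool) N : R :=
  \sum_(w <- words (letters M) N | acc w) \prod_(a <- w) weight a.

(** Summing over all lengths turns the transfer recursion into an inequality with
    a bound that is uniform in the state. *)
Definition cumulative acc T : R := \sum_(0 <= N < T) total acc N.

Lemma weight_ge0 a : 0 <= weight a.
Proof.
by case: a => -[] [l|] //=; rewrite ?mulr_ge0 ?exprn_ge0 ?invr_ge0 ?ler0n ?(subr_ge0 q) //; lra.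
Qed.

Lemma total_ge0 acc N : 0 <= total acc N.
Proof. by apply: sumr_ge0 => w _; apply: prodr_ge0 => a _; apply: weight_ge0. Qed.

Lemma total0 acc : total acc 0 = (acc [::])%:R.
Proof. by rewrite /total /= big_mkcond big_seq1 big_nil; case: ifP. Qed.

Lemma totalS acc N :
  total acc N.+1 =
  \sum_(a <- letters M) weight a * total (fun w => acc (a :: w)) N.
Proof.
rewrite /total wordsS big_mkcond big_allpairs_dep; apply: eq_bigr => a _.
rewrite mulr_sumr [RHS]big_mkcond; apply: eq_bigr => w _.
by case: ifP; rewrite // big_cons.
Qed.

Lemma cumulativeS acc T :
  cumulative acc T.+1 = (acc [::])%:R +
  \sum_(a <- letters M) weight a * cumulative (fun w => acc (a :: w)) T.
Proof.
rewrite /cumulative big_nat_recl // total0; congr (_ + _).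
under eq_bigr do rewrite totalS.
by rewrite exchange_big; apply: eq_bigr => a _; rewrite mulr_sumr.
Qed.

Lemma cumulative0 acc : cumulative acc 0 = 0.
Proof. by rewrite /cumulative big_geq. Qed.

Lemma cumulative_false T : cumulative (fun=> false) T = 0.
Proof. by apply: big1 => N _; rewrite /total big_pred0_eq. Qed.

Lemma total_le_cumulative acc N : total acc N <= cumulative acc N.+1.
Proof.
rewrite /cumulative big_nat_recr //= lerDr; apply: sumr_ge0 => i _.
exact: total_ge0.
Qed.

Lemma geometric_le (c r B : R) (G : nat -> R) : 0 <= r <= 1 -> 0 <= c ->
  0 <= B -> (forall l, G l <= B) ->
  \sum_(0 <= l < M) c * (1 - r) * r ^+ l * G l <= c * B.
Proof.
move=> /andP[r0 r1] c0 B0 GB.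
apply: (@le_trans _ _ (\sum_(0 <= l < M) c * B * ((1 - r) * r ^+ l))).
  apply: ler_sum => l _.
  rewrite [leRHS](_ : _ = c * (1 - r) * r ^+ l * B); last by ring.
  by rewrite ler_wpM2l // !mulr_ge0 ?exprn_ge0 // subr_ge0.
rewrite -mulr_sumr -mulr_sumr -[leRHS]mulr1 ler_wpM2l ?mulr_ge0 //.
rewrite big_mkord -opprB mulNr -subrX1 opprB lerBlDr lerDl.
exact: exprn_ge0.
Qed.

Let half01 : 0 <= (2^-1 : R) <= 1. Proof. by rewrite invr_ge0 ler0n; lra. Qed.

(** Expected number of visits to [0] of a fair walk killed below [0]. The bound
    [2] is a fixed point of the recursion: at height [0] the empty word gives
    [1] and an opener [1 / 2 * 2]; elsewhere both steps give [1 / 2 * 2]. *)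
Lemma cumulative_after u T : cumulative (accept_after u) T <= 2.
Proof.
elim: T u => [|T IH] u; first by rewrite cumulative0.
rewrite cumulativeS big_letters /= cumulative_false mulr0 add0r.
rewrite big1 ?add0r; last by move=> l _; rewrite /= ?cumulative_false mulr0.
have := IH u.+1; case: u => [|u] /= IHu.
  rewrite big1; last by move=> l _; rewrite /= ?cumulative_false mulr0.
  by lra.
have : \sum_(0 <= l < M) 2^-1 * (1 - q) * q ^+ l *
    cumulative (fun w => (l < u.+1)%N && accept_after u w) T <= 2^-1 * 2.
  apply: geometric_le => //; [by rewrite q0|by rewrite invr_ge0 ler0n|move=> l].
  by case: (l < u.+1)%N => //=; rewrite cumulative_false.
by lra.
Qed.

(** The blue excursion before a red step contributes a factor [2] as in
    [cumulative_after], and the red step itself at most [2 * x]. *)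
Lemma cumulative_during s u r b T :
  cumulative (accept_during s u r b) T <= 2 * (4 * x) ^+ s.
Proof.
have B0 k : 0 <= 2 * (4 * x) ^+ k by rewrite mulr_ge0 ?exprn_ge0 ?mulr_ge0.
elim: T s u r b => [|T IH] s u r b; first by rewrite cumulative0.
case: s => [|s].
  rewrite expr0 mulr1; apply: le_trans (cumulative_after u T.+1).
  by rewrite /cumulative; apply: ler_sum => N _; rewrite /total;
    under eq_bigl do rewrite accept_during0.
rewrite cumulativeS big_letters /= add0r exprS.
case: b => [|b] /=.
  rewrite [X in _ + (_ + X)]big1 ?addr0; last by move=> l _; rewrite /= ?cumulative_false mulr0.
  have : \sum_(0 <= l < M) x * (1 - 2^-1) * 2^-1 ^+ l *
      cumulative (fun w => (l < r)%N && accept_during s u r.-1 0 w) T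
      <= x * (2 * (4 * x) ^+ s).
    apply: geometric_le => // l.
    by case: (l < r)%N => /=; rewrite ?cumulative_false.
  have : x * cumulative (accept_during s u r.+1 0) T <= x * (2 * (4 * x) ^+ s).
    by rewrite ler_wpM2l.
  have := IH s.+1 u r 1; rewrite exprS.
  by lra.
rewrite cumulative_false mulr0 add0r.
rewrite big1 ?add0r; last by move=> l _; rewrite /= ?cumulative_false mulr0.
have : \sum_(0 <= l < M) 2^-1 * (1 - q) * q ^+ l *
    cumulative (fun w => (l < b.+1)%N && accept_during s.+1 u r b w) T
    <= 2^-1 * (2 * (4 * x) ^+ s.+1).
  apply: geometric_le => //; [by rewrite q0|by rewrite invr_ge0 ler0n|move=> l].
  by case: (l < b.+1)%N => //=; rewrite cumulative_false.
have := IH s.+1 u r b.+2; rewrite exprS.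
by lra.
Qed.

(** The factor [N] is the number of possible positions of the first red point. *)
Lemma total_accept s u N :
  total (accept s.+1 u) N <= N%:R * (x * (2 * (4 * x) ^+ s)).
Proof.
elim: N u => [|N IH] u; first by rewrite total0 mul0r.
set B := x * (2 * (4 * x) ^+ s) in IH *.
rewrite totalS big_letters /= -[in leRHS]addn1 natrD mulrDl mul1r [leRHS]addrC; apply: lerD.
  rewrite big1 ?addr0; last first.
    by move=> l _; rewrite /total big_pred0_eq mulr0.
  rewrite ler_wpM2l //; apply: le_trans (total_le_cumulative _ _) _.
  exact: cumulative_during.
have : \sum_(0 <= l < M) 2^-1 * (1 - q) * q ^+ l *
    total (fun w => (l < u)%N && accept s.+1 u.-1 w) N <= 2^-1 * (N%:R * B).
  have B0 : 0 <= N%:R * B by rewrite /B !mulr_ge0 ?exprn_ge0 ?mulr_ge0.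
  apply: geometric_le => //; [by rewrite q0|by rewrite invr_ge0 ler0n|move=> l].
  by case: (l < u)%N => /=; [apply: IH | rewrite /total big_pred0_eq].
have := IH u.+1.
by lra.
Qed.

End Weights.

(** * Counting diagrams with a component of a given size *)

Lemma card_openers n (f : 'I_(2 * n) -> 'I_(2 * n)) : matching f ->
  #|[pred i : 'I_(2 * n) | (i < f i)%N]| = n.
Proof.
move=> mf; have [fK fN] := mf.
have e : #|[pred i : 'I_(2 * n) | (f i < i)%N]| = #|[pred i : 'I_(2 * n) | (i < f i)%N]|.
  rewrite -(card_image (can_inj fK) [pred i : 'I_(2 * n) | (f i < i)%N]).
  apply: eq_card => i; rewrite inE; apply/imageP/idP => [[j + ->]|lt].
    by rewrite inE fK.
  by exists (f i); rewrite ?inE fK.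
have := cardID [pred i : 'I_(2 * n) | (i < f i)%N] 'I_(2 * n).
rewrite card_ord.
have -> : #|[predI 'I_(2 * n) & [pred i : 'I_(2 * n) | (i < f i)%N]]| =
    #|[pred i : 'I_(2 * n) | (i < f i)%N]|.
  by apply: eq_card => i; rewrite !inE.
have -> : #|[predD 'I_(2 * n) & [pred i : 'I_(2 * n) | (i < f i)%N]]| =
    #|[pred i : 'I_(2 * n) | (f i < i)%N]|.
  by apply: eq_card => i; rewrite !inE andbT (opener_ltn mf) negbK.
by rewrite e; lia.
Qed.

(** The two ends of a chord with label [l] together weigh [(1 - q) / 4 * q ^ l] if
    blue, which is its share of the weight of the diagram, and
    [(1 - q) / 4 * 2 ^ -l] if red. *)
Lemma code_weight (R : realFieldType) (q x : R) n (f : 'I_(2 * n) -> 'I_(2 * n))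
    (X : {set 'I_(2 * n)}) :
  matching f -> (forall i, i \in X -> f i \in X) -> x ^+ 2 = (1 - q) / 2 ->
  ((1 - q) / 4) ^+ n * q ^+ (\sum_(i | (f i < i)%N) #|crossers f i|) =
  (2 * q) ^+ (\sum_(i in X | (f i < i)%N) #|crossers f i|) *
    \prod_(a <- coloured_code f X 0) weight q x a.
Proof.
move=> mf Xf x2; have [fK fN] := mf.
have fX i : (f i \in X) = (i \in X) by apply/idP/idP => /Xf //; rewrite fK.
have reidx (F : 'I_(2 * n) -> R) :
    \prod_(i | (f i < i)%N) F i = \prod_(i : 'I_(2 * n) | (i < f i)%N) F (f i).
  rewrite (reindex_inj (can_inj fK)); apply: eq_big => //= i; by rewrite fK.
pose w i := weight q x (i \in X, letter f i).
have -> : \prod_(a <- coloured_code f X 0) weight q x a =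
    \prod_(i : 'I_(2 * n) | (i < f i)%N) (w i * w (f i)).
  rewrite /coloured_code drop0 big_map enumT -/(index_enum _) -/(w _).
  rewrite (bigID (fun i : 'I_(2 * n) => (i < f i)%N)) big_split; congr (_ * _).
  by rewrite -reidx; apply: eq_bigl => i; rewrite (opener_ltn mf) negbK.
rewrite -[X in _ ^+ X * _](card_openers mf) -prodr_const -!prodrXr reidx.
rewrite big_mkcondl reidx -!big_split /=; apply: eq_bigr => i lti.
have ltif : (i < f i)%N by [].
rewrite /w /letter fK ltif ltnNge ltnW //= fX; set l := #|_|.
case: (i \in X) => /=.
  rewrite [RHS](_ : _ = x ^+ 2 / 2 * ((2 * q) ^+ l * 2^-1 ^+ l)); last by field.
  by rewrite -exprMn x2 [2 * q]mulrC mulfK ?pnatr_eq0 //; field.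
by field.
Qed.

Lemma sum_inj_le (R : realFieldType) (T : finType) (U : eqType) (B : {set T})
    (W : T -> U) (s : seq U) (P : pred U) (g : U -> R) :
  uniq s -> (forall u, 0 <= g u) -> {in B &, injective W} ->
  (forall b, b \in B -> (W b \in s) && P (W b)) ->
  \sum_(b in B) g (W b) <= \sum_(u <- s | P u) g u.
Proof.
move=> us g0 Winj WP.
have -> : \sum_(b in B) g (W b) = \sum_(u <- [seq W b | b <- enum B]) g u.
  by rewrite big_map big_enum.
set s1 := map _ _.
have us1 : uniq s1.
  by rewrite map_inj_in_uniq ?enum_uniq // => a b; rewrite !mem_enum; apply: Winj.
have -> : \sum_(u <- s1) g u = \sum_(u <- s | P u && (u \in s1)) g u.
  rewrite -[RHS]big_filter; apply: perm_big; apply: uniq_perm => //.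
    exact: filter_uniq.
  move=> u; rewrite mem_filter; apply/idP/idP => [us1u|/andP[/andP[]]] //.
  rewrite us1u andbT; case/mapP: us1u => b; rewrite mem_enum => /WP + ->.
  by rewrite andbC.
by rewrite [leRHS](bigID [in s1]) /= lerDl sumr_ge0.
Qed.

Definition has_component_of_size n k : pred {set {set 'I_(2 * n)}} :=
  fun D => [exists K in components D, #|K| == k].

(** Distinct diagrams have distinct coloured words even though the component is
    chosen arbitrarily, because the letters alone determine the diagram. *)
Lemma component_count (R : rcfType) (q : R) n m k : 0 <= q -> 2 * q <= 1 ->
  (0 < k)%N ->
  #|[set D in chord_diagrams n m | has_component_of_size k D]|%:R *
    (((1 - q) / 4) ^+ n * q ^+ m) <=
  (2 * q) ^+ k.-1 * (n%:R * (8 * (1 - q)) ^+ k).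
Proof.
move=> q0 q2 k0; set B := [set D in _ | _]; set x := Num.sqrt ((1 - q) / 2).
have x0 : 0 <= x by apply: sqrtr_ge0.
have x2 : x ^+ 2 = (1 - q) / 2 by rewrite sqr_sqrtr //; lra.
have q1 : q <= 1 by lra.
pose comp (D : {set {set 'I_(2 * n)}}) := odflt set0 [pick K in components D | #|K| == k].
pose code (D : {set {set 'I_(2 * n)}}) := coloured_code (mate D) (points_of (mate D) (comp D)) 0.
have factsB D : D \in B -> [/\ matching (mate D), D = diagram_of (mate D),
    comp D \in components (diagram_of (mate D)), #|comp D| = k & crossings D = m].
  rewrite !inE => /andP[/andP[Dd /eqP cm] /exists_inP[K KD Kk]].
  have [mm DE] := mateP Dd; rewrite -/(diagram_of _) in DE.
  rewrite -DE /comp; case: pickP => [K' /= /andP[K'D /eqP]|/(_ K)] //.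
  by rewrite KD Kk.
have sat D : D \in B -> saturated (mate D) (points_of (mate D) (comp D)).
  move=> /factsB[mm DE KD _ _]; split=> [i|a c ac]; first exact: points_mate.
  exact: points_cross ac.
(* The component has at least [k - 1] crossings, and [2 * q <= 1]. *)
have step1 : #|B|%:R * (((1 - q) / 4) ^+ n * q ^+ m) <=
    (2 * q) ^+ k.-1 * \sum_(D in B) \prod_(a <- code D) weight q x a.
  rewrite mulr_natl -sumr_const mulr_sumr; apply: ler_sum => D DB.
  have [mm DE KD Kk <-] := factsB D DB; rewrite {1}DE (crossings_sum mm).
  rewrite (code_weight (X := points_of (mate D) (comp D)) mm _ x2); last by case: (sat D DB).
  rewrite ler_wpM2r ?prodr_ge0 //; first by move=> a _; apply: weight_ge0.
  rewrite ler_wiXn2l //; first by lra.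
  by rewrite -Kk; apply: component_labels.
apply: le_trans step1 _; rewrite ler_wpM2l ?exprn_ge0 ?mulr_ge0 //.
have := @total_accept R q x (2 * n) q0 q1 x0 (2 * k).-1 0 (2 * n).
rewrite (_ : (2 * k).-1.+1 = 2 * k)%N; last by lia.
move=> T; apply: le_trans (le_trans _ T) _; last first.
  rewrite natrM (_ : 8 * (1 - q) = (4 * x) ^+ 2); last first.
    by rewrite exprMn x2; field.
  rewrite -exprM -[in leRHS](@prednK (2 * k)%N); last by lia.
  by rewrite exprS [leRHS](_ : _ = 2 * n%:R * (x * (2 * (4 * x) ^+ (2 * k).-1))) //; ring.
apply: sum_inj_le; first exact/uniq_words/uniq_letters.
- by move=> w; apply: prodr_ge0 => a _; apply: weight_ge0.
- move=> D D' DB D'B E.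
  have [mm DE _ _ _] := factsB D DB; have [mm' DE' _ _ _] := factsB D' D'B.
  have El : mate D =1 mate D'.
    apply: letter_inj => // i.
    have /eq_in_map/(_ i) := E; rewrite drop0 mem_enum => /(_ isT).
    by case.
  rewrite DE DE'; apply: eq_imset => i; by rewrite /chord El.
- move=> D DB; have [mm DE KD Kk _] := factsB D DB; apply/andP; split.
    rewrite mem_words size_map size_drop size_enum_ord subn0 eqxx /=.
    apply/allP => -[c o] /mapP[i _ [-> ->]]; rewrite mem_letters /letter.
    case: ifP => // fi.
    have : (#|crossers (mate D) i| <= #|[set~ i]|)%N.
      apply: subset_leq_card; apply/subsetP => c'; rewrite !inE => /andP[/andP[_ ci] _].
      by apply: contraTneq ci => ->; rewrite ltnn.
    by rewrite cardsC1 card_ord; have := ltn_ord i; lia.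
  have cX := card_points mm KD.
  rewrite -Kk -cX.
  have /card_gt0P[i0 i0X] : (0 < #|points_of (mate D) (comp D)|)%N by rewrite cX Kk; lia.
  case: (@arg_minnP _ i0 [in points_of (mate D) (comp D)] (@nat_of_ord _) i0X) => p0 p0X minp.
  case: (@arg_maxnP _ i0 [in points_of (mate D) (comp D)] (@nat_of_ord _) i0X) => p1 p1X maxp.
  apply: (accept_code mm (sat D DB) _ p0X p1X) => //.
  by move=> a y z; apply: points_same_side.
Qed.

(** * Comparing the two counts *)

Lemma component_size_le n (D : {set {set 'I_(2 * n)}}) K :
  is_chord_diagram D -> K \in components D -> (#|K| <= n)%N.
Proof.
move=> /mateP[mm DE]; rewrite {1}DE => KD.
have : (#|points_of (mate D) K| <= 2 * n)%N by rewrite -[leqRHS]card_ord max_card.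
by rewrite (card_points mm KD); lia.
Qed.

Lemma card_large_component n m t :
  (#|[set D in chord_diagrams n m | (t < largest_component D)%N]| <=
   \sum_(t.+1 <= k < n.+1)
     #|[set D in chord_diagrams n m | has_component_of_size k D]|)%N.
Proof.
pose has k (D : {set {set 'I_(2 * n)}}) :=
  (D \in chord_diagrams n m) && has_component_of_size k D.
have -> : (\sum_(t.+1 <= k < n.+1)
     #|[set D in chord_diagrams n m | has_component_of_size k D]| =
   \sum_D \sum_(t.+1 <= k < n.+1) has k D)%N.
  rewrite exchange_big; apply: eq_bigr => k _.
  by rewrite -sum1_card big_mkcond; apply: eq_bigr => D _; rewrite inE /has; case: andb.
rewrite -sum1_card big_mkcond; apply: leq_sum => D _; rewrite inE.
case: (boolP (D \in _)) => //= Dmn; case: ltnP => // lt.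
have [K KD tK] : exists2 K, K \in components D & (t < #|K|)%N.
  apply/exists_inP; apply: contraTT lt => /exists_inPn no; rewrite -leqNgt.
  by apply/bigmax_leqP => K KD; rewrite leqNgt; apply: no.
have Kn : (#|K| <= n)%N.
  by apply: component_size_le KD; move: Dmn; rewrite inE => /andP[].
rewrite (bigD1_seq #|K|) ?iota_uniq ?mem_index_iota ?tK //=.
by rewrite /has Dmn; have -> : has_component_of_size #|K| D by apply/exists_inP; exists K.
Qed.

Lemma up_log_half n : (10 <= n)%N -> (up_log 2 (2 * n) <= n./2)%N.
Proof.
move=> n10; apply: up_log_min => //.
suff h j : (5 <= j)%N -> (4 * j + 2 <= 2 ^ j)%N.
  by apply: leq_trans (h n./2 _); lia.
by elim: j => // j IH; rewrite leq_eqVlt => /orP[/eqP<- //|lt]; have := IH lt; rewrite expnS; lia.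
Qed.

Section Estimate.
Variables (R : rcfType) (n m : nat).
Hypotheses (n10 : (10 <= n)%N) (mn : (14 * m <= n)%N).

Let q : R := m%:R / (n + m)%:R.
Let W : R := ((1 - q) / 4) ^+ n * q ^+ m.
(** The value of [16 * q * (1 - q)] at [q = 1 / 15]. *)
Let theta : R := 224 / 225.

Let N0 : (n + m)%:R != 0 :> R. Proof. by rewrite pnatr_eq0; lia. Qed.
Let N1 : 0 < (n + m)%:R :> R. Proof. by rewrite ltr0n; lia. Qed.

Let q0 : 0 <= q. Proof. by rewrite /q divr_ge0. Qed.

Let q15 : 15 * q <= 1.
Proof. by rewrite /q mulrA ler_pdivrMr // mul1r -natrM ler_nat; lia. Qed.

Let onemq : 1 - q = n%:R / (n + m)%:R.
Proof. by rewrite /q natrD; field; rewrite -natrD. Qed.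

(** With this [q] the weight is exactly [n ^ n * m ^ m] divided by
    [4 ^ n * (n + m) ^ (n + m)]. *)
Lemma card_ge_weight :
  1 <= 1024 * n%:R ^+ 6 * W * #|chord_diagrams n m|%:R.
Proof.
have H0 : (0 < up_log 2 (2 * n))%N by rewrite up_log_gt0; lia.
have H1 := @up_logP 2 (2 * n) isT.
have H2 : (2 ^ up_log 2 (2 * n) <= 4 * n)%N.
  have := @up_log_gtn 2 (2 * n) isT ltac:(lia).
  by rewrite -{2}(prednK H0) expnS; lia.
have H3 := up_log_half n10.
have := @card_chord_diagrams_ge n m _ H0 H1 H2 ltac:(lia).
rewrite -(ler_nat R) !natrM !natrX => h.
have WE : W = n%:R ^+ n * m%:R ^+ m / (4 ^+ n * (n + m)%:R ^+ (n + m)).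
  rewrite /W onemq /q !expr_div_n exprD; field.
  by rewrite !expf_neq0 // pnatr_eq0.
rewrite WE mulrA [X in _ <= X](_ : _ = (1024 * n%:R ^+ 6 * (n%:R ^+ n * m%:R ^+ m) *
   #|chord_diagrams n m|%:R) / (4 ^+ n * (n + m)%:R ^+ (n + m))); last by ring.
by rewrite ler_pdivlMr ?mul1r // mulr_gt0 // exprn_gt0.
Qed.

Lemma component_weight k : (0 < k)%N ->
  #|[set D in chord_diagrams n m | has_component_of_size k D]|%:R * W
    <= 8 * n%:R * theta ^+ k.-1.
Proof.
move=> k0; apply: le_trans (component_count _ _ q0 _ k0) _.
  by have := q15; have := q0; lra.
rewrite -[in X in _ * (_ * X)](prednK k0) exprS.
rewrite [leLHS](_ : _ = 8 * n%:R * ((1 - q) * ((2 * q) * (8 * (1 - q))) ^+ k.-1)); last first.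
  by rewrite [in RHS]exprMn; ring.
rewrite ler_wpM2l ?mulr_ge0 // -[leRHS]mul1r.
have [h0 h1] := (q0, q15); have h2 : 0 <= 1 - q by lra.
have h3 : 0 <= 2 * q * (8 * (1 - q)) by rewrite !mulr_ge0 ?invr_ge0.
apply: ler_pM.
- by lra.
- exact: exprn_ge0.
- by lra.
- by rewrite lerXn2r ?nnegrE /theta //; [lra|nra].
Qed.

Lemma large_component_le t :
  #|[set D in chord_diagrams n m | (t < largest_component D)%N]|%:R <=
  8192 * n%:R ^+ 8 * theta ^+ t * #|chord_diagrams n m|%:R.
Proof.
set B := #|_|; set C := #|chord_diagrams n m|.
have th : 0 <= theta <= 1 by rewrite /theta; lra.
have [th0 th1] := andP th.
have W0 : 0 <= W by rewrite /W mulr_ge0 ?exprn_ge0 // onemq !divr_ge0.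
have BW : B%:R * W <= 8 * n%:R ^+ 2 * theta ^+ t.
  have := card_large_component n m t; rewrite -/B -(ler_nat R) natr_sum => h.
  apply: le_trans (ler_wpM2r W0 h) _; rewrite mulr_suml.
  apply: (@le_trans _ _ (\sum_(t.+1 <= k < n.+1) 8 * n%:R * theta ^+ t)).
    rewrite big_nat [leRHS]big_nat; apply: ler_sum => k /andP[tk _].
    apply: le_trans (component_weight _) _; first by lia.
    by rewrite ler_wpM2l ?mulr_ge0 // ler_wiXn2l //; lia.
  rewrite sumr_const_nat -[leLHS]mulr_natr.
  rewrite [leRHS](_ : _ = 8 * n%:R * theta ^+ t * n%:R); last by ring.
  by rewrite ler_wpM2l ?mulr_ge0 ?exprn_ge0 // ler_nat; lia.
have CW := card_ge_weight; rewrite -/C in CW.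
apply: (@le_trans _ _ (B%:R * (1024 * n%:R ^+ 6 * W * C%:R))).
  by rewrite ler_peMr.
rewrite [leLHS](_ : _ = B%:R * W * (1024 * n%:R ^+ 6 * C%:R)); last by ring.
rewrite [leRHS](_ : _ = 8 * n%:R ^+ 2 * theta ^+ t * (1024 * n%:R ^+ 6 * C%:R)); last by ring.
by rewrite ler_wpM2r ?mulr_ge0 ?exprn_ge0.
Qed.

End Estimate.

(** * The limit *)

From mathcomp Require Import all_classical all_reals all_analysis.
Import Order.TTheory GRing.Theory Num.Theory.
Import numFieldNormedType.Exports.
Local Open Scope classical_set_scope.
Local Open Scope ring_scope.

(** The constant is [2025 = 9 * 225]: since [224 / 225 <= exp (- 1 / 225)], an
    exponent above [2025 * ln n] gives at most [n ^ -9], which beats the factor [n ^ 8]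
    of [large_component_le]. *)
Lemma theta_pow_le (R : realType) (n t : nat) : (0 < n)%N ->
  2025 * ln n%:R < t.+1%:R :> R ->
  (224 / 225 : R) ^+ t * n%:R ^+ 9 <= 2.
Proof.
move=> n0 ht; set th : R := 224 / 225.
have th0 : 0 < th by rewrite /th; lra.
have the : th <= expR (- (225)^-1).
  by apply: le_trans (expR_ge1Dx _); rewrite /th; lra.
have h : th ^+ t.+1 <= expR (- (9%:R * ln n%:R)).
  apply: (@le_trans _ _ (expR (- (225)^-1) ^+ t.+1)).
    by rewrite lerXn2r // nnegrE ?expR_ge0 // ltW.
  rewrite -expRM_natl ler_expR; lra.
rewrite expRN expRM_natl lnK ?posrE ?ltr0n // in h.
have n9 : 0 < (n%:R : R) ^+ 9 by rewrite exprn_gt0 // ltr0n.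
have : th ^+ t.+1 * n%:R ^+ 9 <= 1.
  by rewrite -ler_pdivlMr // mul1r.
rewrite exprS -mulrA; set y := th ^+ t * _; rewrite /th; have : 0 <= y.
  by rewrite mulr_ge0 ?exprn_ge0 // ltW.
by lra.
Qed.

Lemma uniform_pr_ge (R : realType) (n m : nat) :
  (10 <= n)%N -> (14 * m <= n)%N ->
  0 <= 1 - uniform_pr R (chord_diagrams n m)
    (fun D => (largest_component D)%:R <= 2025 * ln (n%:R : R))
  <= 16384 / n%:R.
Proof.
move=> n10 mn; set P := fun D => _.
set C := chord_diagrams n m.
have C0 : 0 < #|C|%:R :> R.
  rewrite lt0r ler0n andbT; apply/negP => /eqP C0.
  by have := card_ge_weight R n10 mn; rewrite C0 mulr0 ler10.
have n0 : 0 < n%:R :> R by rewrite ltr0n; lia.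
have ln0 : 0 <= 2025 * ln (n%:R : R).
  apply: mulr_ge0; first exact: ler0n.
  by apply: ln_ge0; rewrite ler1n; lia.
have [t ht lt_t] : exists2 t : nat, 2025 * ln (n%:R : R) < t.+1%:R &
    forall l : nat, 2025 * ln (n%:R : R) < l%:R -> (t < l)%N.
  move: (2025 * _) ln0 => a a0; have /andP[h1 h2] := truncn_itv a0.
  exists (Num.truncn a) => // l al; rewrite -(ltr_nat R); exact: le_lt_trans al.
have split : #|C| = (#|[set x in C | P x]%SET| + #|[set x in C | ~~ P x]%SET|)%N.
  rewrite -(cardsID [set x | P x]%SET C); congr (_ + _)%N; apply: eq_card => x;
    by rewrite !inE // andbC.
have -> : 1 - uniform_pr R C P = #|[set x in C | ~~ P x]%SET|%:R / #|C|%:R.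
  have C1 : #|C|%:R != 0 :> R by rewrite gt_eqF.
  rewrite /uniform_pr -[X in X - _](divff C1) -mulrBl; congr (_ / _).
  by rewrite split natrD addrAC subrr add0r.
rewrite divr_ge0 //= ler_pdivrMr //.
apply: le_trans (_ : #|[set D in C | (t < largest_component D)%N]%SET|%:R <= _).
  rewrite ler_nat; apply: subset_leq_card; apply/fintype.subsetP => D.
  rewrite !inE => /andP[-> /=]; rewrite /P -ltNge.
  exact: lt_t.
apply: le_trans (large_component_le R n10 mn t) _; rewrite ler_wpM2r //.
rewrite ler_pdivlMr //.
have np : (0 < n)%N by lia.
have := theta_pow_le np ht.
rewrite (_ : 8192 * _ * _ * _ = 8192 * ((224 / 225) ^+ t * n%:R ^+ 9)); last by ring.
by lra.
Qed.

Theorem theorem4p9 (R : realType) :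
  exists A : R, 0 < A /\
    forall m : nat -> nat,
      (forall n : nat, (m n)%:R <= n%:R / 14 :> R) ->
      (fun n : nat =>
         uniform_pr R (chord_diagrams n (m n))
           (fun D => (largest_component D)%:R <= A * ln (n%:R : R)))
        @ \oo --> (1 : R).
Proof.
exists 2025; split; first by rewrite ltr0n.
move=> m hm.
apply/cvgrPdist_le => e e0; near=> n.
have n10 : (10 <= n)%N by near: n; exact: nbhs_infty_ge.
have mn : (14 * m n <= n)%N.
  by rewrite -(ler_nat R) natrM; have := hm n; lra.
have /andP[h0 h1] := uniform_pr_ge R n10 mn.
rewrite ger0_norm //; apply: le_trans h1 _.
rewrite ler_pdivrMr ?ltr0n; last by lia.
rewrite mulrC -ler_pdivrMr //.
by near: n; exact: nbhs_infty_ger.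
Unshelve. all: by end_near. Qed.
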